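(* Let $k$ be an algebraically closed field of characteristic $p>0$. Then Mustaţă–Nakamura's conjecture holds for pairs $(\mathbb{A}_k^2,\mathfrak a^e)$ in $\mathcal M_k$: for every finite subset $e\subset\mathbb{R}_{>0}$ there is a positive integer $\ell_e$ (depending on $e$) such that for every pair $(\mathbb{A}_k^2,\mathfrak a^e)\in\mathcal M_k$ with exponent $e$ there is a prime divisor $E$ over $\mathbb{A}_k^2$ that computes $\mathrm{mld}(0;\mathbb{A}_k^2,\mathfrak a^e)$ and satisfies $k_E\le \ell_e$.
   Context: Let $A=\mathbb{A}_k^N=\operatorname{Spec}k[X_1,\dots,X_N]$, with origin $0$. A pair $(A,\mathfrak a^e)$ consists of $A$ and a multiideal $\mathfrak a^e=\mathfrak a_1^{e_1}\cdots\mathfrak a_s^{e_s}$ with exponent $e=\{e_1,\dots,e_s\}\subset\mathbb{R}_{>0}$ a finite set, where $\mathfrak a_1,\dots,\mathfrak a_s$ are ideals of $k[X_1,\dots,X_N]$. A prime divisor $E$ over $A$ is a prime divisor on some normal $A'$ with a birational morphism $A'\to A$; $\mathrm{val}_E$ is the corresponding valuation and $k_E$ is the coefficient at $E$ of the relative canonical divisor $K_{A'/A}$. The log discrepancy is $a(E;A,\mathfrak a^e)=k_E-\sum_i e_i\,\mathrm{val}_E(\mathfrak a_i)+1$. For $N\ge 2$, $\mathrm{mld}(0;A,\mathfrak a^e)=\inf\{a(E;A,\mathfrak a^e)\mid E \text{ a prime divisor over } A \text{ with center } 0\}$. For $N=1$ it is defined by the same formula if the right-hand side is non-negative, and is $-\infty$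 otherwise. A prime divisor $E$ over $A$ with center $\{0\}$ computes $\mathrm{mld}(0;A,\mathfrak a^e)$ if $a(E;A,\mathfrak a^e)=\mathrm{mld}(0;A,\mathfrak a^e)$ when $\mathrm{mld}(0;A,\mathfrak a^e)\ge 0$, and if $a(E;A,\mathfrak a^e)<0$ when $\mathrm{mld}(0;A,\mathfrak a^e)=-\infty$. A prime divisor $E$ over $\mathbb{A}_k^N$ is a toric prime divisor if there is $w\in\mathbb{Z}_{\ge0}^N$ such that $\mathrm{val}_E(f)=\min\{\sum_i w_iu_i\mid X^u \text{ appears in } f \text{ with nonzero coefficient}\}$ for all polynomials $f$. $\mathrm{mld}(0;\mathbb{A}_k^N,\mathfrak a^e)$ has a toric approximation if either for every $\epsilon>0$ there exists a toric prime divisor $E_\epsilon$ over $\mathbb{A}_k^N$ such that $|a(E_\epsilon;\mathbb{A}_k^N,\mathfrak a^e)-\mathrm{mld}(0;\mathbb{A}_k^N,\mathfrak a^e)|<\epsilon$, or there exists a toric prime divisor over $\mathbb{A}_k^N$ computing $\mathrm{mld}(0;\mathbb{A}_k^N,\mathfrak a^e)$. $\mathcal M_k$ is the set of pairs $(\mathbb{A}_k^N,\mathfrak a^e)$ with $N\ge 1$ and $e\subset\mathbb{R}_{>0}$ such that $\mathrm{mld}(0;\mathbb{A}_k^N,\mathfrak a^e)$ has a toric approximation. *)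

(* Defs.v *)
From HB Require Import structures.
From mathcomp Require Import all_boot all_order all_algebra.
From mathcomp Require Import finmap.
From mathcomp Require Import boolp classical_sets reals constructive_ereal ereal.
(* The notations of mpoly clash with those of mathcomp-analysis. *)
From mathcomp Require Import -(notations) mpoly.

Set Implicit Arguments.
Unset Strict Implicit.
Unset Printing Implicit Defensive.

Import Order.TTheory GRing.Theory Num.Theory.

Local Open Scope classical_set_scope.
Local Open Scope ring_scope.

Notation polyring k N := (mpoly.mpoly N k).
Notation funfield k N := ({fraction (polyring k N)}).
Notation toK f := (@FracField.tofrac _ f).

Definition constK (k : fieldType) (N : nat) (c : k) : funfield k N :=
  toK (mpoly.mpolyC N c).

Definition is_ideal (A : comNzRingType) (I : set A) : Prop :=
  [/\ I 0, (forall x y, I x -> I y -> I (x + y)) &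
      (forall r x, I x -> I (r * x))].

Section Subrings.
Variable K : fieldType.
Implicit Types B P Q : set K.

Definition is_prime_of B P : Prop :=
  [/\ P `<=` B, P 0, (forall x y, P x -> P y -> P (x + y)),
      (forall r x, B r -> P x -> P (r * x)) &
      ~ P 1 /\ (forall x y, B x -> B y -> P (x * y) -> P x \/ P y)].

Definition is_height_one_prime B P : Prop :=
  [/\ is_prime_of B P, P <> [set 0] &
      forall Q, is_prime_of B Q -> Q `<=` P -> Q = [set 0] \/ Q = P].

Definition is_integrally_closed B : Prop :=
  forall (x : K) (q : {poly K}),
    q \is monic -> (forall i, B q`_i) -> root q x -> B x.

End Subrings.

Section PrimeDivisors.
Variables (k : fieldType) (N : nat).
Local Notation K := (funfield k N).

(* B is a finitely generated k-algebra between k[X_1, ..., X_N] and K. *)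
Definition is_chart (B : set K) : Prop :=
  (exists (m : nat) (g : 'I_m -> K),
     B = range (fun q : polyring k m => mpoly.mmap (@constK k N) g q)) /\
  (forall f : polyring k N, B (toK f)).

(* A prime divisor on a normal A' birational over the affine N-space, given on
   an affine open subset Spec B of A' that meets it: through A' -> A the ring B
   is a normal k-algebra of finite type between k[X_1, ..., X_N] and its field
   of fractions, and the divisor is the closure of a point P of codimension 1.
   Everything below depends only on the local ring B_P. *)
Record prime_divisor := PrimeDivisor {
  pd_ring : set K;
  pd_prime : set K;
  pd_chart : is_chart pd_ring;
  pd_normal : is_integrally_closed pd_ring;
  pd_height_one : is_height_one_prime pd_ring pd_prime }.

Variable E : prime_divisor.

Definition local_ring : set K :=
  [set x | exists a b, [/\ pd_ring E a, pd_ring E b, ~ pd_prime E b & x = a / b]].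

Definition local_max_ideal : set K :=
  [set x | exists a b, [/\ pd_prime E a, pd_ring E b, ~ pd_prime E b & x = a / b]].

Definition is_uniformizer (t : K) : Prop :=
  local_max_ideal = [set t * u | u in local_ring].

Definition frac_ideal (n : int) : set K :=
  [set x | exists t u, [/\ is_uniformizer t, local_ring u & x = t ^ n * u]].

Definition valE (R : realType) (x : K) : \bar R :=
  ereal_sup [set (n%:~R)%:E | n in [set n : int | frac_ideal n x]].

Definition val_ideal (R : realType) (I : set (polyring k N)) : \bar R :=
  ereal_inf [set valE R (toK f) | f in I].

Definition fracderiv (i : 'I_N) (x : K) : K :=
  let n := \n_(repr x) in let d := \d_(repr x) in
  (toK (mpoly.mderiv i n) * toK d - toK n * toK (mpoly.mderiv i d)) / toK d ^+ 2.

(* df_1 /\ ... /\ df_N = jacobian f * (dX_1 /\ ... /\ dX_N) *)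
Definition jacobian (f : 'I_N -> K) : K :=
  \det (\matrix_(i < N, j < N) fracderiv j (f i)).

(* The coefficient of K_{A'/A} at E is the order along E of dX_1 /\ ... /\ dX_N
   as a rational section of the canonical sheaf of A'. At the generic point of
   E, where A' is regular, this sheaf is the top exterior power of the Kaehler
   differentials of B_P over k (k being perfect); inside K dX_1 /\ ... /\ dX_N
   it is the B_P-module generated by the df_1 /\ ... /\ df_N with f_i in B_P.
   If its generator is g dX_1 /\ ... /\ dX_N, then valE g is the least value
   of a jacobian, and the order in question is - valE g. *)
Definition kE (R : realType) : \bar R :=
  ereal_sup [set (- valE R (jacobian f))%E | f in
               [set f : 'I_N -> K | forall i, local_ring (f i)]].

Definition center : set (polyring k N) := [set f | pd_prime E (toK f)].

Definition center_at_origin : Prop :=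
  center = [set f : polyring k N | mpoly.meval (fun=> 0) f = 0].

Definition is_toric (R : realType) : Prop :=
  exists w : 'I_N -> nat, forall f : polyring k N,
    valE R (toK f) =
    ereal_inf [set ((\sum_(i < N) w i * u i)%N%:R)%:E
              | u in [set u : mpoly.multinom N | mpoly.mcoeff u f != 0]].

End PrimeDivisors.

(* The pair consisting of the affine N-space and the product of the ideals
   mi_ideal c with exponents c, c running over e. *)
Record multiideal (k : fieldType) (N : nat) (R : realType) (e : {fset R}) :=
  Multiideal {
    mi_ideal : e -> set (polyring k N);
    mi_idealP : forall c : e, is_ideal (mi_ideal c) }.

Section Mld.
Variables (k : fieldType) (N : nat) (R : realType) (e : {fset R}).
Variable a : multiideal k N e.
Local Open Scope ereal_scope.

Definition log_discrepancy (E : prime_divisor k N) : \bar R :=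
  kE E R - \sum_(c : e) (fsval c)%:E * val_ideal E R (mi_ideal a c) + 1.

Definition mld_inf : \bar R :=
  ereal_inf [set log_discrepancy E | E in [set E | center_at_origin E]].

Definition mld : \bar R :=
  if (N == 1)%N && (mld_inf < 0) then -oo else mld_inf.

Definition computes_mld (E : prime_divisor k N) : Prop :=
  center_at_origin E /\
  ((0 <= mld /\ log_discrepancy E = mld) \/
   (mld = -oo /\ log_discrepancy E < 0)).

Definition has_toric_approximation : Prop :=
  (forall eps : R, (0 < eps)%R ->
     exists E : prime_divisor k N,
       is_toric E R /\ `| log_discrepancy E - mld | < eps%:E) \/
  (exists E : prime_divisor k N, is_toric E R /\ computes_mld E).

Definition in_Mk : Prop :=
  [/\ (0 < N)%N, (forall c, c \in e -> (0 < c)%R) & has_toric_approximation].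

End Mld.

(* Main.v *)
Require Import Defs.
From HB Require Import structures.
From mathcomp Require Import all_boot all_order all_algebra.
From mathcomp Require Import finmap polyXY.
From mathcomp Require Import boolp classical_sets filter reals constructive_ereal ereal.
From mathcomp Require Import -(notations) mpoly.
From mathcomp Require Import zify ring lra.

(** A toric divisor of weight w has k_E = w_1 + w_2 - 1, so its log discrepancy
    a(w) = w_1 + w_2 - sum_i e_i min_(u in S_i) <w, u> depends only on the set
    S_i of the exponents that occur in the ideal a_i.  A limit along an
    ultrafilter, together with Dickson's lemma, bounds in terms of e alone a
    weight w that has a(w) < 0 or minimizes a over all positive weights.  If
    a(w) < 0, then the weights n w + b drive the mld to -oo and E_w computes it.
    Otherwise a toric approximation by divisors centered at the origin makes the
    mld equal to the minimum a(w).  The definition also allows the approximating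
    divisors to be the coordinate axes; then a(1,0) < a(1,1) or a(0,1) < a(1,1),
    the ideals have small multiplicity away from that axis, and inversion of
    adjunction, proved by blowing up points, shows that every divisor centered
    at the origin has log discrepancy at least a(w'), where w' is the primitive
    weight proportional to (val_E X, val_E Y). *)

Set Implicit Arguments.
Unset Strict Implicit.
Unset Printing Implicit Defensive.

Import Order.TTheory GRing.Theory Num.Theory.

Local Open Scope ring_scope.

(** * Toric log discrepancies *)

(** The exponents are arbitrary reals, so the values of a need not form a discrete set and a minimum
    over infinitely many weights is not automatic. In a putative sequence of exponent sets violating
    every bound, nonnegativity of a(w) caps the i-th minimal weight by (w_1 + w_2)/e_i, so at a
    fixed w the minimum survives in the limit; and finitely many generators of the limit lie in
    almost all members, so the limit function bounds theirs from below at all w at once. Together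
    these facts carry a minimizer of the limit back to a member. The axes are delicate because they
    are not centered at the origin and say nothing directly about the mld, yet their log discrepancy
    can lie below that of every positive weight; what is then needed is a lower bound for arbitrary,
    nontoric divisors. For this a divisor is reduced to its valuation v on k(X, Y), 2-forms to the
    bracket D_0 f D_1 g - D_1 f D_0 g, whose least value on the valuation ring is -k_E, and blowing
    up to dividing one coordinate by the other. *)

Lemma dickson (T : Type) (gs : seq (T -> nat)) (A : T -> Prop) :
  exists F : seq T, (forall y, List.In y F -> A y) /\
    forall x, A x -> exists2 y, List.In y F & all (fun g => g y <= g x)%N gs.
Proof.
elim: gs A => [|g gs IH] A.
  have [[x Ax]|nA] := pselect (exists x, A x).
    by exists [:: x]; split => [y [<-//|[]]|z _]; exists x => //; left.
  by exists [::]; split => // x Ax; case: nA; exists x.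
have [F [FA Fdom]] := IH A.
(* [F] dominates for the functions in [gs], and also for [g] at every [x] with [g x >= N]. Below
   [N], each of the finitely many slices where [g] is constant is covered by the induction
   hypothesis. *)
pose N := (\max_(y <- F) g y)%N.
have gN y : List.In y F -> (g y <= N)%N.
  rewrite /N; elim: (F) => //= z F' IHF [->|/IHF le]; rewrite big_cons.
    exact: leq_maxl.
  exact: leq_trans le (leq_maxr _ _).
have [G [GA Gdom]] : exists G : seq T, (forall y, List.In y G -> A y) /\
    forall x, A x -> (g x < N)%N ->
      exists2 y, List.In y G & all (fun h => h y <= h x)%N (g :: gs).
  elim: {gN}N => [|N [G [GA Gdom]]]; first by exists [::].
  have [H [HA Hdom]] := IH (fun x => A x /\ g x = N).
  exists (G ++ H); split => [y /List.in_app_iff[/GA//|/HA[]//]|x Ax].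
  rewrite ltnS leq_eqVlt => /orP[/eqP gx|/(Gdom _ Ax)[y yG yx]].
    have [y yH yx] := Hdom x (conj Ax gx).
    exists y; first by apply/List.in_app_iff; right.
    by rewrite /= yx gx (HA _ yH).2 leqnn.
  by exists y => //; apply/List.in_app_iff; left.
exists (F ++ G); split => [y /List.in_app_iff[/FA|/GA]//|x Ax].
have [lt|ge] := ltnP (g x) N.
  have [y yG yx] := Gdom x Ax lt.
  by exists y => //; apply/List.in_app_iff; right.
have [y yF yx] := Fdom x Ax.
exists y; first by apply/List.in_app_iff; left.
by rewrite /= yx (leq_trans (gN _ yF) ge).
Qed.

Definition wt (w u : nat * nat) : nat := (w.1 * u.1 + w.2 * u.2)%N.

(** The support function of the Newton polygon of [S], with default value 0 for empty [S]. *)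
Definition minwt (S : set (nat * nat)) (w : nat * nat) : nat :=
  if pselect (exists n, `[< exists2 u, S u & wt w u = n >]) is left ex
  then ex_minn ex else 0%N.

Lemma minwt_le S w u : S u -> (minwt S w <= wt w u)%N.
Proof.
move=> Su; rewrite /minwt; case: pselect => [ex|[]]; last first.
  by exists (wt w u); apply/asboolP; exists u.
by case: ex_minnP => m _; apply; apply/asboolP; exists u.
Qed.

Lemma minwt_ex S w : (exists u, S u) -> exists2 u, S u & minwt S w = wt w u.
Proof.
move=> [u Su]; rewrite /minwt; case: pselect => [ex|[]]; last first.
  by exists (wt w u); apply/asboolP; exists u.
by case: ex_minnP => m /asboolP[v Sv <-] _; exists v.
Qed.

Lemma minwt_eq S w u : S u -> (forall v, S v -> (wt w u <= wt w v)%N) ->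
  minwt S w = wt w u.
Proof.
move=> Su min; apply/eqP; rewrite eqn_leq minwt_le //=.
by have [v Sv ->] := @minwt_ex S w (ex_intro _ u Su); apply: min.
Qed.

Definition addw (w v : nat * nat) : nat * nat := (w.1 + v.1, w.2 + v.2)%N.
Definition scalew (n : nat) (w : nat * nat) : nat * nat := (n * w.1, n * w.2)%N.

Lemma wt_addw w v u : wt (addw w v) u = (wt w u + wt v u)%N.
Proof. rewrite /wt /=; lia. Qed.

Lemma wt_scalew n w u : wt (scalew n w) u = (n * wt w u)%N.
Proof. rewrite /wt /=; lia. Qed.

Lemma nat_gt_ex (R : realType) (x : R) : exists n : nat, x < n%:R.
Proof.
by exists (Num.bound `|x|); apply: le_lt_trans (ler_norm x) (archi_boundP (normr_ge0 x)).
Qed.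

Section ToricDiscrepancy.
Variables (R : realType) (I : finType) (C : I -> R).
Hypothesis C_gt0 : forall i, 0 < C i.
Implicit Type S : I -> set (nat * nat).

(* The log discrepancy of the toric divisor of weight w, when S i is the set of
   the exponents occurring in the i-th ideal and C i is the exponent of this
   ideal. *)
Definition tdisc S (w : nat * nat) : R :=
  (w.1 + w.2)%:R - \sum_i C i * (minwt (S i) w)%:R.

Lemma tdisc_scalew S n w : (forall i, exists u, S i u) ->
  tdisc S (scalew n w) = n%:R * tdisc S w.
Proof.
move=> S0; rewrite /tdisc mulrBr -mulnDr natrM mulr_sumr; congr (_ - _).
apply: eq_bigr => i _; rewrite mulrCA -natrM; congr (_ * _%:R).
have [u Su mu] := minwt_ex w (S0 i).
rewrite mu -wt_scalew; apply: minwt_eq => // v Sv.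
by rewrite !wt_scalew leq_mul2l -mu minwt_le ?orbT.
Qed.

(** A minimum of linear functions is superadditive, and it enters [tdisc] with a minus sign. *)
Lemma tdisc_addw_le S w v : (forall i, exists u, S i u) ->
  tdisc S (addw w v) <= tdisc S w + tdisc S v.
Proof.
move=> S0; rewrite /tdisc /= addrACA -natrD addnACA lerD2l -opprD lerN2.
rewrite -big_split /=; apply: ler_sum => i _; rewrite -mulrDr -natrD.
apply: ler_wpM2l; first exact: ltW.
have [u Su ->] := minwt_ex (addw w v) (S0 i).
by rewrite ler_nat wt_addw leq_add // minwt_le.
Qed.

Definition pos (w : nat * nat) : bool := (0 < w.1)%N && (0 < w.2)%N.

(** Dickson's lemma, applied to the coordinates of [w] together with the slacks of finitely many
    generators of each [S i], leaves finitely many candidates: every positive weight lies on a ray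
    from a candidate along which [tdisc] is affine, and a negative slope would contradict
    nonnegativity. *)
Lemma tdisc_min_ex S : (forall i, exists u, S i u) ->
  (forall w, pos w -> 0 <= tdisc S w) ->
  exists2 w, pos w & forall w', pos w' -> tdisc S w <= tdisc S w'.
Proof.
move=> S0 Sge0.
have gensP i : exists F : seq (nat * nat), (forall u, List.In u F -> S i u) /\
    forall u, S i u -> exists2 v, List.In v F & forall w, (wt w v <= wt w u)%N.
  have [F [FS Fdom]] := dickson [:: fst; snd] (S i).
  exists F; split=> // u /Fdom[v vF /and3P[le1 le2 _]]; exists v => // w.
  by rewrite /wt leq_add // leq_mul2l ?le1 ?le2 orbT.
have [gens gensE] := choice gensP.
pose slack i u w := (wt w u - minwt (S i) w)%N.
pose fs : seq (nat * nat -> nat) :=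
  fst :: snd :: flatten [seq [seq slack i u | u <- gens i] | i <- enum I].
have [F [Fpos Fdom]] := dickson fs pos.
have in_fs i u (P : pred (nat * nat -> nat)) : List.In u (gens i) ->
    all P fs -> P (slack i u).
  move=> uF /= /and3P[_ _].
  elim: (enum I) (mem_enum I i) => //= j s IH; rewrite inE all_cat.
  case: eqVneq => [<- _ /andP[+ _]|_ /IH{}IH /andP[_ /IH]//].
  elim: (gens i) uF => //= v s' IH'.
  by move=> [<-|/IH'{}IH'] /andP[].
(* The componentwise difference d of w and the element y of F below it attains
   each minimum together with y, so the toric discrepancy is additive on the
   rays from y in the direction d. *)
have dom w : pos w -> exists2 y, List.In y F & tdisc S y <= tdisc S w.
  move=> /[dup] wpos /Fdom[y yF le]; exists y => //.
  have ypos := Fpos _ yF.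
  have /and3P[le1 le2 _] := le.
  pose d : nat * nat := (w.1 - y.1, w.2 - y.2)%N.
  have wE : w = addw y d.
    by rewrite /addw /= !subnKC //; case: (w).
  (* A generator with zero slack at [w] has zero slack at [y], and slacks do not decrease from [y]
     to [w]; hence a single [u] attains the minimum along the whole ray. *)
  have act i : exists2 u, S i u & forall n,
      minwt (S i) (addw y (scalew n d)) = wt (addw y (scalew n d)) u.
    have [u0 Su0 mu0] := minwt_ex w (S0 i).
    have [u uF uu0] := (gensE i).2 _ Su0.
    have Su := (gensE i).1 _ uF.
    have mu : minwt (S i) w = wt w u.
      by apply/eqP; rewrite eqn_leq minwt_le //= mu0.
    have yu : minwt (S i) y = wt y u.
      have := in_fs i u _ uF le; rewrite /slack mu subnn leqn0 subn_eq0 => ge.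
      by apply/eqP; rewrite eqn_leq ge minwt_le.
    exists u => // n; apply: minwt_eq => // v Sv.
    have [v' v'F v'v] := (gensE i).2 _ Sv.
    apply: leq_trans (v'v _).
    have := in_fs i v' _ v'F le; rewrite /slack mu yu.
    have := minwt_le y ((gensE i).1 _ v'F); rewrite yu.
    have := minwt_le w ((gensE i).1 _ v'F); rewrite mu.
    rewrite !wt_addw !wt_scalew wE !wt_addw => A1 A2 A3.
    have {A1 A3} dd : (wt d u <= wt d v')%N by lia.
    by apply: leq_add => //; rewrite leq_mul2l dd orbT.
  have [L HL] : exists L, forall n,
      tdisc S (addw y (scalew n d)) = tdisc S y + n%:R * L.
    exists ((d.1 + d.2)%:R - \sum_i C i * (minwt (S i) (addw y d) - minwt (S i) y)%:R).
    move=> n; rewrite /tdisc /= mulrBr -addnACA natrD -mulnDr natrM.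
    rewrite [RHS]addrACA; congr (_ + _); rewrite -opprD mulr_sumr -big_split /=.
    congr (- _); apply: eq_bigr => i _; rewrite mulrCA -mulrDr -natrM -natrD.
    congr (_ * _%:R); have [u _ Eu] := act i.
    have -> : addw y d = addw y (scalew 1 d).
      by rewrite /scalew !mul1n; case: (d).
    have -> : minwt (S i) y = minwt (S i) (addw y (scalew 0 d)).
      by rewrite /scalew /addw !mul0n !addn0; case: (y).
    by rewrite !Eu !wt_addw !wt_scalew mul1n mul0n addn0 addnC addKn addnC.
  suff : 0 <= L.
    move=> L0; rewrite wE.
    have := HL 1%N; rewrite /scalew !mul1n -surjective_pairing => ->.
    by rewrite mul1r lerDl.
  rewrite leNgt; apply/negP => L0.
  have [n ny] := nat_gt_ex (tdisc S y / - L).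
  have := Sge0 (addw y (scalew n d)).
  rewrite HL leNgt => /(_ _)/negP; apply; first by move: ypos; rewrite /pos /=; lia.
  by move: ny; rewrite ltr_pdivrMr ?oppr_gt0 // mulrN -subr_gt0 -opprD oppr_gt0 addrC.
have minF (s : seq (nat * nat)) : s != [::] ->
    exists2 w, List.In w s & forall y, List.In y s -> tdisc S w <= tdisc S y.
  elim: s => // w [_ _|w' s /(_ isT)[v vs vmin] _].
    by exists w; [left|move=> y [<-|[]]].
  have [le|lt] := leP (tdisc S w) (tdisc S v).
    exists w; first by left.
    by move=> y [<-//|/vmin]; apply: le_trans.
  exists v; first by right.
  by move=> y [<-|/vmin//]; apply: ltW.
have [|w wF wmin] := minF F.
  by have [//|y] := dom (1, 1)%N; case: (F).
exists w; first exact: Fpos.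
by move=> w' /dom[y /wmin]; apply: le_trans.
Qed.

Lemma tdisc_bounded_min : exists l : nat, forall S,
  (forall i, exists u, S i u) ->
  exists w, [/\ pos w, (w.1 + w.2 <= l)%N &
    tdisc S w < 0 \/ forall w', pos w' -> tdisc S w <= tdisc S w'].
Proof.
apply: contrapT => /forallNP noL.
(* A counterexample to the bound [l]: the positive weights of size at most [l] have nonnegative
   discrepancy and none of them is minimal. *)
have badP l : exists S, (forall i, exists u, S i u) /\
    forall w, pos w -> (w.1 + w.2 <= l)%N ->
    0 <= tdisc S w /\ exists2 w', pos w' & tdisc S w' < tdisc S w.
  have /existsNP[S /not_implyP[S0 nS]] := noL l.
  exists S; split=> // w wpos wl.
  have /not_orP[/negP neg /existsNP[w' /not_implyP[w'pos /negP lt]]] :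
      ~ (tdisc S w < 0 \/ forall w', pos w' -> tdisc S w <= tdisc S w').
    by move=> H; apply: nS; exists w.
  by rewrite -leNgt in neg; rewrite -ltNge in lt; split=> //; exists w'.
have [T TP] := choice badP.
have [U [UU Uoo]] := ultraFilterLemma eventually_filter.
have FU : ProperFilter U by exact: ultra_proper.
have Uge n : U [set m | (n <= m)%N]%classic.
  by apply: Uoo; exists n.
have UI (A B : set nat) : U A -> U B -> U [set n | A n /\ B n]%classic.
  exact: filterI.
have Uex (A : set nat) : U A -> exists n, A n by exact: filter_ex.
have Uall (J : Type) (s : seq J) (P : J -> set nat) :
    (forall j, List.In j s -> U (P j)) ->
    U [set n | forall j, List.In j s -> P j n]%classic.
  elim: s => [|j s IH] H; first by apply: filterE => n j [].
  have Us := IH (fun j' js => H j' (or_intror js)).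
  apply: filterS (UI _ _ (H j (or_introl erefl)) Us) => n [Pj Ps] j' [<-//|].
  exact: Ps.
(* The ultralimit of the sets [T n i]: an exponent belongs to it when it occurs in [U]-almost all of
   them. *)
pose L i : set (nat * nat) := [set u | U [set n | T n i u]]%classic.
have Lmin i w : pos w ->
    exists2 u, L i u & U [set n | minwt (T n i) w = wt w u]%classic.
  move=> wpos.
  have [B ltB] := nat_gt_ex ((w.1 + w.2)%:R / C i).
  pose P u : set nat := [set n | T n i u /\ minwt (T n i) w = wt w u]%classic.
  suff [u Pu] : exists u, U (P u).
    by exists u; apply: filterS Pu => n [].
  apply: contrapT => /forallNP noP.
  pose s := [seq (a, b) | a <- iota 0 B.+1, b <- iota 0 B.+1].
  have /Uex[n [nw nP]] := UI _ _ (Uge (w.1 + w.2)%N)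
    (Uall _ s (fun u => (~` P u)%classic) (fun u _ => 
      or_ind (fun H => False_ind _ (noP u H)) id (in_ultra_setVsetC (P u) UU))).
  have [u Tu mu] := minwt_ex w ((TP n).1 i).
  have [disc_ge0 _] := (TP n).2 w wpos nw.
  (* The other terms of the sum being nonnegative, a nonnegative discrepancy bounds this single
     minimum. As [w] is positive, only the finitely many exponents in [s] could attain it, yet [nP]
     rules out all of them. *)
  have : C i * (minwt (T n i) w)%:R <= (w.1 + w.2)%:R.
    apply: le_trans (_ : _ <= \sum_j C j * (minwt (T n j) w)%:R) _; last first.
      by rewrite -subr_ge0.
    by rewrite (bigD1 i) //= lerDl sumr_ge0 // => j _; rewrite mulr_ge0 // ltW.
  rewrite mulrC -ler_pdivlMr // => /le_lt_trans/(_ ltB); rewrite ltr_nat mu => uB.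
  have /andP[u1 u2] : (u.1 <= B)%N && (u.2 <= B)%N.
    by move: uB wpos; rewrite /wt /pos; case: (w) (u) => ? ? [? ?] /=; nia.
  suff us : List.In u s by apply: (nP u us).
  suff: u \in s by move=> {nP}; elim: (s) => // x s' IH; rewrite inE => /predU1P[->|/IH]; [left|right].
  by rewrite [u]surjective_pairing allpairs_f // mem_iota.
have L0 i : exists u, L i u.
  by have [u Lu _] := Lmin i (1, 1)%N isT; exists u.
(* Uniform in [w]: [T n i] need only contain the finitely many Dickson generators of [L i]. *)
have Lge i : U [set n | forall w, (minwt (T n i) w <= minwt (L i) w)%N]%classic.
  have [F [FL Fdom]] := dickson [:: fst; snd] (L i).
  apply: filterS (Uall _ F (fun u => [set n | T n i u]%classic) FL) => n FT w.
  have [u /Fdom[v vF /and3P[le1 le2 _]] ->] := minwt_ex w (L0 i).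
  apply: leq_trans (minwt_le w (FT _ vF)) _.
  by rewrite /wt leq_add // leq_mul2l ?le1 ?le2 orbT.
have Leq i w : pos w -> U [set n | minwt (T n i) w = minwt (L i) w]%classic.
  move=> wpos; have [u Lu Uu] := Lmin i w wpos.
  apply: filterS (UI _ _ Uu (Lge i)) => n [eq le].
  by apply/eqP; rewrite eqn_leq le eq minwt_le.
have {Lge}Lge : U [set n | forall w, tdisc L w <= tdisc (T n) w]%classic.
  have H : U [set n | forall i w, (minwt (T n i) w <= minwt (L i) w)%N]%classic.
    exact: (filter_forall _ Lge).
  apply: filterS H => n le w.
  rewrite lerD2l lerN2; apply: ler_sum => i _.
  by apply: ler_wpM2l; [apply: ltW|rewrite ler_nat].
have {Leq}Leq w : pos w -> U [set n | tdisc L w = tdisc (T n) w]%classic.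
  move=> wpos.
  have H : U [set n | forall i, minwt (T n i) w = minwt (L i) w]%classic.
    exact: (filter_forall _ (fun i => Leq i w wpos)).
  apply: filterS H => n eq.
  by rewrite /tdisc; congr (_ - _); apply: eq_bigr => i _; rewrite eq.
have [w wpos wmin] : exists2 w, pos w & forall w', pos w' -> tdisc L w <= tdisc L w'.
  apply: tdisc_min_ex => // w wpos.
  have /Uex[n [le ->]] := UI _ _ (Uge (w.1 + w.2)%N) (Leq w wpos).
  by have [] := (TP n).2 w wpos le.
have /Uex[n [[le eq] ge]] := UI _ _ (UI _ _ (Uge (w.1 + w.2)%N) (Leq w wpos)) Lge.
(* At the minimizer [w] of the limit, [T n] and [L] agree; a smaller value of [T n] at [w'] would
   force [L] below its minimum there. *)
have [_ [w' w'pos]] := (TP n).2 w wpos le.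
rewrite ltNge -eq => /negP; apply.
exact: le_trans (wmin _ w'pos) (ge w').
Qed.

End ToricDiscrepancy.

(** * Polynomials in two variables *)

(** The relation says that f/g is integral. After cancelling the gcd, [g'] divides a power of the
    coprime [f'], so it is a constant. Gcd and divisibility are those over the fraction field of
    [R], whence the factor [d]. *)
Lemma integral_dvdp (R : idomainType) (f g : {poly R}) n (c : nat -> {poly R}) :
  g != 0 -> f ^+ n + \sum_(i < n) c i * f ^+ i * g ^+ (n - i) = 0 ->
  exists2 d : R, d != 0 & exists q, d *: f = q * g.
Proof.
move=> g0 E; suff /Pdiv.Idomain.dvdpP[[d q] /= d0 dE] : g %| f.
  by exists d => //; exists q.
pose h := gcdp f g.
have h0 : h != 0 by rewrite gcdp_eq0 (negPf g0) andbF.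
have [/= u u0 [f' fE]] : exists2 u : R, u != 0 & exists f', u *: f = f' * h.
  by have /Pdiv.Idomain.dvdpP[[u q] /=] := dvdp_gcdl f g; exists u => //; exists q.
have [/= v v0 [g' gE]] : exists2 v : R, v != 0 & exists g', v *: g = g' * h.
  by have /Pdiv.Idomain.dvdpP[[v q] /=] := dvdp_gcdr f g; exists v => //; exists q.
have cop : coprimep f' g'.
  rewrite /coprimep -dvdp1 -(dvdp_mul2r _ _ h0) mul1r.
  rewrite -(eqp_dvdl _ (gcdp_mul2r _ _ _)) -fE -gE.
  rewrite (eqp_dvdl _ (eqp_trans (eqp_gcdl _ (eqp_scale _ u0)) (eqp_gcdr _ (eqp_scale _ v0)))).
  exact: dvdpp.
have homog : (v *: f') ^+ n + \sum_(i < n) c i * (v *: f') ^+ i * (u *: g') ^+ (n - i) = 0.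
  apply: (mulIf (expf_neq0 n h0)); rewrite mul0r mulrDl -exprMn mulr_suml.
  have -> : v *: f' * h = (v * u) *: f by rewrite -scalerAl -fE scalerA.
  rewrite -[RHS](mulr0 ((v * u) ^+ n)%:P) -[in RHS]E mulrDr mul_polyC -exprZn; congr (_ + _).
  rewrite mulr_sumr; apply: eq_bigr => i _.
  have -> : h ^+ n = h ^+ i * h ^+ (n - i) by rewrite -exprD subnKC // ltnW.
  rewrite mulrACA -[X in X * _ = _]mulrA -!exprMn.
  have -> : v *: f' * h = (v * u) *: f by rewrite -scalerAl -fE scalerA.
  have -> : u *: g' * h = (v * u) *: g by rewrite -scalerAl -gE scalerA mulrC.
  have -> : (v * u) ^+ n = (v * u) ^+ i * (v * u) ^+ (n - i).
    by rewrite -exprD subnKC // ltnW.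
  rewrite !exprZn -!mul_polyC polyCM; ring.
have g'1 : g' %| 1.
  rewrite -(Gauss_dvdpl _ (coprimep_expr n (_ : coprimep g' f'))) ?mul1r; last first.
    by rewrite coprimep_sym.
  have : g' %| (v *: f') ^+ n.
    move/eqP: homog; rewrite addr_eq0 => /eqP->; rewrite dvdpNr.
    apply: (big_ind (fun q => g' %| q)) => [|x y|i _]; rewrite ?dvdp0 //.
      exact: dvdp_add.
    by rewrite dvdp_mull // -subnSK // exprS dvdp_mulr // dvdpZr.
  by rewrite exprZn dvdpZr // expf_neq0.
have gh : g %| h.
  rewrite -(eqp_dvdl _ (eqp_scale _ v0)) gE -[X in _ %| X]mul1r dvdp_mul //.
exact: dvdp_trans gh (dvdp_gcdl _ _).
Qed.

Section Integral.
Variable k : fieldType.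
Implicit Types f g : {poly {poly k}}.

(** This is the normality of k[X, Y], with denominators cleared. Division in each of the two
    variables leaves a denominator in the other variable only, and two such denominators have no
    common factor. *)
Lemma integral_dvd f g n (c : nat -> {poly {poly k}}) :
  g != 0 -> f ^+ n + \sum_(i < n) c i * f ^+ i * g ^+ (n - i) = 0 ->
  exists q, f = q * g.
Proof.
move=> g0 E.
have [a a0 [q aE]] := integral_dvdp g0 E.
have sg0 : swapXY g != 0 by rewrite swapXY_eq0.
have sE : swapXY f ^+ n +
    \sum_(i < n) swapXY (c i) * swapXY f ^+ i * swapXY g ^+ (n - i) = 0.
  rewrite -[RHS](rmorph0 (@swapXY k)) -[in RHS]E rmorphD rmorphXn rmorph_sum /=.
  by congr (_ + _); apply: eq_bigr => i _; rewrite !rmorphM !rmorphXn.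
have [b b0 [q' bE]] := integral_dvdp (c := fun i => swapXY (c i)) sg0 sE.
(* Now a(Y) f = q g and b(X) f = q' g, so that a(Y) divides b(X) q; as a is
   monic in Y up to a constant and b is a constant in Y, a(Y) divides q. *)
have key : b *: swapXY q = q' * a^:P.
  apply: (mulIf sg0); rewrite -scalerAl -rmorphM -aE -[a *: f]mul_polyC rmorphM /=.
  by rewrite swapXY_polyC scalerAr bE mulrCA mulrA.
pose l := (lead_coef a)^-1%:P : {poly k}.
have l0 : l != 0 by rewrite polyC_eq0 invr_eq0 lead_coef_eq0.
pose m := l *: a^:P.
have mM : m \is monic.
  rewrite monicE lead_coefZ lead_coef_map_inj //; last exact: polyC_inj.
  by rewrite -polyCM mulVf ?lead_coef_eq0.
have [r qE] : exists r, swapXY q = r * m.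
  exists (Pdiv.Ring.rdivp (swapXY q) m).
  rewrite [LHS](Pdiv.RingMonic.rdivp_eq mM); set r := Pdiv.Ring.rmodp _ _.
  suff -> : r = 0 by rewrite addr0.
  apply: contraTeq (Pdiv.Ring.ltn_rmodpN0 (swapXY q) (monic_neq0 mM)) => r0.
  rewrite -/r -leqNgt -(size_scale r b0).
  pose d := q' * (lead_coef a)%:P%:P - b *: Pdiv.Ring.rdivp (swapXY q) m.
  have brE : b *: r = d * m.
    rewrite mulrBl -scalerAl; apply/eqP.
    rewrite -[_ == _](inj_eq (addrI (b *: (Pdiv.Ring.rdivp (swapXY q) m * m)))).
    rewrite -scalerDr -(Pdiv.RingMonic.rdivp_eq mM) key addrC subrK.
    rewrite /m -mul_polyC mulrA -(mulrA q') -rmorphM -rmorphM divff ?lead_coef_eq0 //.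
    by rewrite !rmorph1 mulr1.
  have d0 : d != 0.
    have : b *: r != 0 by rewrite -mul_polyC mulf_neq0 ?polyC_eq0.
    by rewrite brE; apply: contraNneq => ->; rewrite mul0r.
  by rewrite brE size_Mmonic // -(prednK (_ : 0 < size d)%N) ?size_poly_gt0 // leq_addl.
exists (swapXY (l *: r)); apply: (can_inj (@swapXYK k)); rewrite rmorphM /= swapXYK.
apply: (mulfI (_ : a^:P != 0)); first by rewrite map_polyC_eq0.
rewrite -swapXY_polyC -rmorphM mul_polyC aE rmorphM. rewrite /= qE /m swapXY_polyC.
by rewrite -!mul_polyC; ring.
Qed.

End Integral.

Lemma poly_split (R : nzRingType) (F : {poly R}) : exists G, F = (F`_0)%:P + 'X * G.
Proof.
exists (\poly_(i < size F) F`_i.+1); apply/polyP => i.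
rewrite coefD coefC coefXM coef_poly; case: i => [|i] /=; first by rewrite addr0.
rewrite add0r; case: ltnP => // /leqW le; first by rewrite nth_default.
Qed.

Lemma poly_order (R : nzRingType) (F : {poly R}) : F != 0 ->
  exists n G, [/\ F = 'X^n * G, G`_0 != 0 & G`_0 = F`_n].
Proof.
move=> F0; have ex : exists n, F`_n != 0.
  by exists (size F).-1; rewrite -lead_coefE lead_coef_eq0.
case: (ex_minnP ex) => n Fn min.
have FE : F = 'X^n * drop_poly n F.
  rewrite -[LHS](poly_take_drop n) commr_polyXn.
  rewrite [X in X + _](_ : _ = 0) ?add0r //; apply/polyP => i.
  rewrite coef_take_poly coef0; case: ltnP => // lt.
  by apply/eqP; apply: contraTT lt => /min; rewrite leqNgt.
by exists n, (drop_poly n F); rewrite coef_drop_poly add0n.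
Qed.

Fact ev_key : unit. Proof. by []. Qed.

Section Evaluation.
Variables (k A : comNzRingType) (c : {rmorphism k -> A}) (a b : A).

(* ev evaluates the outer variable 'X at a and the inner variable 'Y at b. *)
Definition ev1 : {poly k} -> A :=
  locked_with ev_key (horner_morph (fun x => mulrC b (c x))).

Fact ev1_is_zmod_morphism : zmod_morphism ev1.
Proof. by move=> p q; rewrite /ev1 unlock rmorphB. Qed.
Fact ev1_is_monoid_morphism : monoid_morphism ev1.
Proof. by split=> [|p q]; rewrite /ev1 unlock ?rmorph1 ?rmorphM. Qed.
HB.instance Definition _ :=
  GRing.isZmodMorphism.Build {poly k} A ev1 ev1_is_zmod_morphism.
HB.instance Definition _ :=
  GRing.isMonoidMorphism.Build {poly k} A ev1 ev1_is_monoid_morphism.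

Definition ev : {poly {poly k}} -> A :=
  locked_with ev_key (horner_morph (fun x => mulrC a (ev1 x))).

Fact ev_is_zmod_morphism : zmod_morphism ev.
Proof. by move=> p q; rewrite /ev unlock rmorphB. Qed.
Fact ev_is_monoid_morphism : monoid_morphism ev.
Proof. by split=> [|p q]; rewrite /ev unlock ?rmorph1 ?rmorphM. Qed.
HB.instance Definition _ :=
  GRing.isZmodMorphism.Build {poly {poly k}} A ev ev_is_zmod_morphism.
HB.instance Definition _ :=
  GRing.isMonoidMorphism.Build {poly {poly k}} A ev ev_is_monoid_morphism.

Lemma ev0 : ev 0 = 0. Proof. exact: rmorph0. Qed.
Lemma evE1 : ev 1 = 1. Proof. exact: rmorph1. Qed.
Lemma evD F G : ev (F + G) = ev F + ev G. Proof. exact: rmorphD. Qed.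
Lemma evB F G : ev (F - G) = ev F - ev G. Proof. exact: rmorphB. Qed.
Lemma evM F G : ev (F * G) = ev F * ev G. Proof. exact: rmorphM. Qed.
Lemma evXn F n : ev (F ^+ n) = ev F ^+ n. Proof. exact: rmorphXn. Qed.

Lemma ev1C x : ev1 x%:P = c x. Proof. by rewrite /ev1 unlock horner_morphC. Qed.
Lemma ev1X : ev1 'X = b. Proof. by rewrite /ev1 unlock horner_morphX. Qed.
Lemma evC q : ev q%:P = ev1 q. Proof. by rewrite /ev unlock horner_morphC. Qed.
Lemma evX : ev 'X = a. Proof. by rewrite /ev unlock horner_morphX. Qed.
Lemma evY : ev 'Y = b. Proof. by rewrite evC ev1X. Qed.

End Evaluation.

Lemma poly2_rmorph_eq (k A : comNzRingType) (f g : {rmorphism {poly {poly k}} -> A}) :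
  (forall x, f x%:P%:P = g x%:P%:P) -> f 'X = g 'X -> f 'Y = g 'Y -> f =1 g.
Proof.
move=> eC eX eY; apply: poly_ind => [|F q IH]; first by rewrite !rmorph0.
rewrite !rmorphD !rmorphM /= IH eX; congr (_ + _).
elim/poly_ind: q => [|q x IHq]; first by rewrite polyC0 !rmorph0.
by rewrite !polyCD !polyCM !rmorphD !rmorphM /= IHq eY eC.
Qed.

(** * Derivations and valuations *)

Section Derivations.
Variables (k : comNzRingType) (K : fieldType) (c : {rmorphism k -> K}).

Definition is_derivation (D : K -> K) : Prop :=
  [/\ forall x y, D (x + y) = D x + D y, forall x y, D (x * y) = D x * y + x * D y
    & forall x, D (c x) = 0].

Lemma derivation1 D : is_derivation D -> D 1 = 0.
Proof. by move=> [_ _ /(_ 1)]; rewrite rmorph1. Qed.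

Lemma derivationX D x n : is_derivation D -> x != 0 -> D (x ^+ n) / x ^+ n = n%:R * (D x / x).
Proof.
move=> DD x0; have [_ DM _] := DD; elim: n => [|n IH].
  by rewrite expr0 derivation1 // !mul0r.
rewrite exprS DM invfM mulrDl -natr1 mulrDl mul1r addrC; congr (_ + _).
  by rewrite -IH mulrACA divff // mul1r.
by rewrite mulrACA divff ?expf_neq0 // mulr1.
Qed.

Lemma derivationM D x y : is_derivation D -> x != 0 -> y != 0 ->
  D (x * y) / (x * y) = D x / x + D y / y.
Proof. by move=> [_ DM _] x0 y0; rewrite DM; field; rewrite x0 y0. Qed.

Lemma derivationV D x : is_derivation D -> x != 0 -> D x^-1 / x^-1 = - (D x / x).
Proof.
move=> DD x0; apply/eqP; rewrite -addr_eq0 -derivationM ?invr_eq0 // mulVf //.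
by rewrite derivation1 // mul0r.
Qed.

Lemma derivation_div D x y : is_derivation D -> y != 0 ->
  D (x / y) = (D x * y - x * D y) / y ^+ 2.
Proof.
move=> DD y0; have [_ DM _] := DD; rewrite DM.
have -> : D y^-1 = - (D y / y) * y^-1 by rewrite -derivationV // mulfVK ?invr_eq0.
by field.
Qed.

Lemma derivationZ D x (n : int) : is_derivation D -> x != 0 ->
  D (x ^ n) / x ^ n = n%:~R * (D x / x).
Proof.
move=> DD x0; case: n => n; first by rewrite -exprnP derivationX.
rewrite NegzE -exprnN derivationV ?expf_neq0 // derivationX //.
by rewrite rmorphN mulNr.
Qed.

(** Chain rule; [F1] and [F2] do not depend on [D], so two derivations can be expanded with the same
    coefficients in a bracket. *)
Lemma derivation_ev s u F : exists F1 F2, forall D, is_derivation D ->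
  D (ev c s u F) = ev c s u F1 * D s + ev c s u F2 * D u.
Proof.
elim/poly_ind: F => [|F q [F1 [F2 IH]]].
  exists 0, 0 => D DD; rewrite !rmorph0 !mul0r addr0.
  by have [_ _] := DD; move/(_ 0); rewrite rmorph0.
have [q' qE] : exists q', forall D, is_derivation D -> D (ev1 c u q) = ev1 c u q' * D u.
  elim/poly_ind: q => [|q x [q' IHq]].
    exists 0 => D DD; rewrite !rmorph0 mul0r.
    by have [_ _] := DD; move/(_ 0); rewrite rmorph0.
  exists (q' * 'X + q) => D DD; have [DA DM DC] := DD.
  by rewrite !rmorphD !rmorphM /= ev1C ev1X DA DM DC IHq //; ring.
exists (F1 * 'X + F), (F2 * 'X + q'%:P) => D DD; have [DA DM DC] := DD.
by rewrite !rmorphD !rmorphM /= !evC evX DA DM IH // qE //; ring.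
Qed.

Variables D0 D1 : K -> K.
Hypotheses (HD0 : is_derivation D0) (HD1 : is_derivation D1).

(** For the two partial derivatives, the coefficient of dx /\ dy with respect to dX /\ dY. *)
Definition bracket (x y : K) : K := D0 x * D1 y - D1 x * D0 y.

(** The same coefficient for the logarithmic form dx/x /\ dy/y. *)
Definition logbracket (x y : K) : K := bracket x y / (x * y).

Lemma logbracketE x y :
  logbracket x y = (D0 x / x) * (D1 y / y) - (D1 x / x) * (D0 y / y).
Proof. by rewrite /logbracket /bracket invfM; ring. Qed.

Lemma bracket_log x y : x != 0 -> y != 0 -> bracket x y = logbracket x y * (x * y).
Proof. by move=> x0 y0; rewrite divfK // mulf_neq0. Qed.

Lemma bracketC x y : bracket y x = - bracket x y.
Proof. by rewrite /bracket; ring. Qed.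

End Derivations.

Section Valuations.
Variable K : fieldType.
Implicit Types x y : K.

(* The value of v at 0 is junk, whence the disjunction. *)
Definition vge (v : K -> int) (n : int) x : bool := (x == 0) || (n <= v x).

Definition is_valuation (v : K -> int) : Prop :=
  (forall x y, x != 0 -> y != 0 -> v (x * y) = v x + v y) /\
  (forall n x y, vge v n x -> vge v n y -> vge v n (x + y)).

Variable v : K -> int.
Hypothesis Hv : is_valuation v.

Lemma vge0 n : vge v n 0. Proof. by rewrite /vge eqxx. Qed.

Lemma vge_neq0 n x : x != 0 -> vge v n x = (n <= v x).
Proof. by rewrite /vge => /negPf->. Qed.

Lemma valM x y : x != 0 -> y != 0 -> v (x * y) = v x + v y.
Proof. exact: Hv.1. Qed.

Lemma val1 : v 1 = 0.
Proof. by have := @valM 1 1; rewrite oner_eq0 mulr1 => /(_ isT isT); lia. Qed.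

Lemma valV x : x != 0 -> v x^-1 = - v x.
Proof.
move=> x0; have := @valM x x^-1 x0; rewrite invr_eq0 divff // val1 => /(_ x0); lia.
Qed.

Lemma valX x n : x != 0 -> v (x ^+ n) = n%:Z * v x.
Proof.
move=> x0; elim: n => [|n IH]; first by rewrite expr0 val1 mul0r.
by rewrite exprS valM ?expf_neq0 // IH; lia.
Qed.

Lemma valZ x (n : int) : x != 0 -> v (x ^ n) = n * v x.
Proof.
move=> x0; case: n => n; first by rewrite -exprnP valX.
by rewrite NegzE -exprnN valV ?expf_neq0 // valX // mulNr.
Qed.

Lemma valN x : v (- x) = v x.
Proof.
have [->|x0] := eqVneq x 0; first by rewrite oppr0.
have N10 : (-1 : K) != 0 by rewrite oppr_eq0 oner_eq0.
have : v (-1) + v (-1) = 0 by rewrite -(valM N10 N10) mulrNN mulr1 val1.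
by have -> : - x = (-1) * x; [rewrite mulN1r|rewrite (valM N10 x0) => ?; lia].
Qed.

Lemma vgeN n x : vge v n (- x) = vge v n x.
Proof. by rewrite /vge oppr_eq0 valN. Qed.

Lemma vgeD n x y : vge v n x -> vge v n y -> vge v n (x + y).
Proof. exact: Hv.2. Qed.

Lemma vgeB n x y : vge v n x -> vge v n y -> vge v n (x - y).
Proof. by move=> vx vy; rewrite vgeD // vgeN. Qed.

Lemma vgeM m n x y : vge v m x -> vge v n y -> vge v (m + n) (x * y).
Proof.
rewrite /vge mulf_eq0; case: (eqVneq x 0) => //= x0; case: (eqVneq y 0) => //= y0.
by rewrite valM //; lia.
Qed.

Lemma vge_le m n x : m <= n -> vge v n x -> vge v m x.
Proof. by rewrite /vge; case: eqP => //= _; lia. Qed.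

Lemma vgeMl n x y : vge v 0 x -> vge v n y -> vge v n (x * y).
Proof. by move=> vx vy; rewrite -[n]add0r vgeM. Qed.

Lemma valD_lt x y : x != 0 -> vge v (v x + 1) y -> x + y != 0 /\ v (x + y) = v x.
Proof.
move=> x0 vy; have vx : vge v (v x) x by rewrite vge_neq0.
have vy' : vge v (v x) y by apply: vge_le vy; lia.
have xy0 : x + y != 0.
  apply: contraTneq vy => /eqP; rewrite addr_eq0 => /eqP xE.
  rewrite xE valN vge_neq0; first lia.
  by rewrite -oppr_eq0 -xE.
split=> //; apply/le_anti/andP; split; last by rewrite -vge_neq0 // vgeD.
rewrite leNgt; apply/negP => lt.
have : vge v (v x + 1) (x + y - y) by apply: vgeB => //; rewrite vge_neq0 //; lia.
by rewrite addrK vge_neq0 //; lia.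
Qed.

End Valuations.

(** * Blow-up charts and residues of a valuation *)

Section Blowup.
Variable k : comNzRingType.

Definition polyCC : k -> {poly {poly k}} := polyC \o polyC.
HB.instance Definition _ := GRing.RMorphism.on polyCC.

Lemma ev_comp (A : comNzRingType) (c : {rmorphism k -> A}) a b P Q F :
  ev c a b (ev polyCC P Q F) = ev c (ev c a b P) (ev c a b Q) F.
Proof.
have := @poly2_rmorph_eq k A (ev c a b \o ev polyCC P Q) (ev c (ev c a b P) (ev c a b Q)).
apply => [x||] /=; rewrite ?evX ?evY //.
by rewrite !evC !ev1C evC ev1C.
Qed.

(* The total transform of F under (X, Y) |-> (X, XY). *)
Lemma coef_blowup (F : {poly {poly k}}) d e :
  (ev polyCC 'X ('X * 'Y) F)`_d`_e = if (e <= d)%N then F`_(d - e)`_e else 0.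
Proof.
have coef1 q d' e' : (ev1 polyCC ('X * 'Y) q)`_d'`_e' = if d' == e' then q`_e' else 0.
  elim/poly_ind: q d' e' => [|q x IH] d' e'; first by rewrite rmorph0 !coef0 if_same.
  rewrite rmorphD rmorphM /= ev1X ev1C; move: (ev1 _ _ q) IH => P IH.
  rewrite (mulrC 'X) mulrA coefD coefMX coefMC.
  case: d' => [|d'] /=.
    rewrite add0r /polyCC /= !coefC /= coefD coefMX coefC.
    by case: e' => [|e'] //=; rewrite add0r.
  rewrite coefC /= addr0 coefMX; case: e' => [|e'] //=.
  by rewrite IH eqSS coefD coefMX coefC /= addr0.
elim/poly_ind: F d e => [|F q IH] d e; first by rewrite rmorph0 !coef0 if_same.
rewrite rmorphD rmorphM /= evX evC !coefD !coefMX coef1 coefC subn_eq0.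
case: d => [|d] /=; first by rewrite leqn0 coef0 !add0r eq_sym.
rewrite IH; case: (ltngtP e d.+1) => [lt|gt|->].
- by rewrite -ltnS lt coef0 subSn.
- by rewrite leqNgt ltnW //= addr0.
- by rewrite ltnn coef0.
Qed.

End Blowup.

Section Residues.
Variables (k : closedFieldType) (K : fieldType) (c : {rmorphism k -> K}) (v : K -> int).
Hypotheses (Hv : is_valuation v) (Hc : forall x, x != 0 -> v (c x) = 0).

Lemma vgeC x : vge v 0 (c x).
Proof.
have [->|x0] := eqVneq x 0; first by rewrite rmorph0 vge0.
by rewrite vge_neq0 ?fmorph_eq0 // Hc.
Qed.

Lemma vge_ev1 u q : vge v 0 u -> vge v 0 (ev1 c u q).
Proof.
move=> vu; elim/poly_ind: q => [|q x IH]; first by rewrite rmorph0 vge0.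
rewrite rmorphD rmorphM /= ev1X ev1C vgeD ?vgeC //.
by rewrite -[0]addr0 vgeM.
Qed.

Lemma vge_ev s u F : vge v 0 s -> vge v 0 u -> vge v 0 (ev c s u F).
Proof.
move=> vs vu; elim/poly_ind: F => [|F q IH]; first by rewrite rmorph0 vge0.
rewrite rmorphD rmorphM /= evX evC vgeD ?vge_ev1 //.
by rewrite -[0]addr0 vgeM.
Qed.

(** As [k] is algebraically closed, a residue that differs from every constant is transcendental
    over [k]. *)
Definition residually_transcendental u := forall x, u - c x != 0 /\ v (u - c x) = 0.

Lemma residually_transcendental_vge u : residually_transcendental u -> vge v 0 u.
Proof. by move=> /(_ 0)[]; rewrite rmorph0 subr0 => u0 vu; rewrite vge_neq0 // vu. Qed.

(** The polynomial splits into linear factors, each of which is a unit at [u]. *)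
Lemma ev1_unit u q : residually_transcendental u -> q != 0 ->
  ev1 c u q != 0 /\ v (ev1 c u q) = 0.
Proof.
move=> tu q0; have [r qE] := closed_field_poly_normal q.
rewrite qE -mul_polyC rmorphM /= ev1C.
have l0 : lead_coef q != 0 by rewrite lead_coef_eq0.
have [n0 v0] : ev1 c u (\prod_(z <- r) ('X - z%:P)) != 0 /\
               v (ev1 c u (\prod_(z <- r) ('X - z%:P))) = 0.
  elim: (r) => [|z r' [IH1 IH2]]; first by rewrite big_nil rmorph1 oner_eq0 val1.
  have [z0 vz] := tu z.
  rewrite big_cons rmorphM rmorphB /= ev1X ev1C mulf_neq0 //; split=> //.
  by rewrite valM // vz IH2.
by rewrite mulf_neq0 ?fmorph_eq0 // valM ?fmorph_eq0 // Hc // v0.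
Qed.

(** Modulo [s] only the constant term in the outer variable survives, and it is a unit at [u]. *)
Lemma ev_unit s u (F : {poly {poly k}}) : vge v 1 s -> residually_transcendental u -> F`_0 != 0 ->
  ev c s u F != 0 /\ v (ev c s u F) = 0.
Proof.
move=> vs tu F0; have [G FE] := poly_split F.
have [q0 vq] := ev1_unit tu F0.
rewrite FE rmorphD rmorphM /= evX evC -vq; apply: valD_lt => //.
rewrite vq add0r -[1]addr0; apply: vgeM => //; apply: vge_ev.
  exact: vge_le vs.
exact: residually_transcendental_vge.
Qed.

Lemma ev_unit0 s u (F : {poly {poly k}}) : vge v 1 s -> vge v 1 u -> F`_0`_0 != 0 ->
  ev c s u F != 0 /\ v (ev c s u F) = 0.
Proof.
move=> vs vu F0; have [G FE] := poly_split F; have [q qE] := poly_split F`_0.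
rewrite FE rmorphD rmorphM /= evX evC {}qE rmorphD rmorphM /= ev1X ev1C -addrA.
rewrite -(Hc F0); apply: valD_lt; rewrite ?fmorph_eq0 //.
rewrite Hc // add0r -[1]addr0 vgeD // vgeM //.
  by apply: vge_ev1; apply: vge_le vu.
by apply: vge_ev; [apply: vge_le vs|apply: vge_le vu].
Qed.

(** On a curve with affine coordinate [u], the center of [v] is either a closed point u = x or the
    whole curve. *)
Lemma residue_cases u : vge v 0 u ->
  (exists x, vge v 1 (u - c x)) \/ residually_transcendental u.
Proof.
move=> vu; have [ex|nex] := pselect (exists x, vge v 1 (u - c x)); [by left|right=> x].
have : vge v 0 (u - c x) by rewrite vgeB ?vgeC.
have : ~~ vge v 1 (u - c x) by apply/negP => H; apply: nex; exists x.
by rewrite /vge; case: eqP => //= _; move: (v _) => n; split=> //; lia.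
Qed.

Variables D0 D1 : K -> K.
Hypotheses (HD0 : is_derivation c D0) (HD1 : is_derivation c D1).
Notation bracket := (bracket D0 D1).
Notation logbracket := (logbracket D0 D1).

Section Generators.
Variables s u : K.
Hypotheses (vs : v s = 1) (s0 : s != 0) (tu : residually_transcendental u).
Hypothesis gen : forall x, exists F G : {poly {poly k}}, ev c s u G != 0 /\ x = ev c s u F / ev c s u G.

(** Under the hypotheses of the section, [v] is the order along the line s = 0 of the plane with
    coordinates [s] and [u]. *)
Lemma val_ev_gen (F : {poly {poly k}}) : F != 0 -> exists n G, [/\ F = 'X^n * G, G`_0 != 0,
  ev c s u G != 0 /\ v (ev c s u G) = 0 & v (ev c s u F) = n].
Proof.
move=> F0; have [n [G [FE G0 _]]] := poly_order F0.
have vs1 : vge v 1 s by rewrite vge_neq0 ?vs.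
have [e0 ve] := ev_unit vs1 tu G0.
exists n, G; split=> //.
by rewrite FE rmorphM rmorphXn /= evX valM ?expf_neq0 // valX // ve vs mulr1 addr0.
Qed.

Lemma vge_gen x : vge v 0 x -> exists F G : {poly {poly k}},
  [/\ x = ev c s u F / ev c s u G, ev c s u G != 0 & v (ev c s u G) = 0].
Proof.
have [F [G [G0 ->]]] := gen x.
have [->|F0] := eqVneq F 0.
  by exists 0, 1; rewrite !rmorph0 !rmorph1 !mul0r oner_eq0 val1.
have G0' : G != 0 by apply: contraNneq G0 => ->; rewrite rmorph0.
have [m [F' [FE _ [F'0 vF']  vF]]] := val_ev_gen F0.
have [n [G' [GE _ [G'0 vG'] vG]]] := val_ev_gen G0'.
have eF0 : ev c s u F != 0 by rewrite FE rmorphM rmorphXn /= evX mulf_neq0 ?expf_neq0.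
rewrite vge_neq0 ?mulf_neq0 ?invr_eq0 // valM ?invr_eq0 // valV // vF vG => le.
exists ('X^(m - n) * F'), G'; split=> //.
rewrite FE GE !rmorphM !rmorphXn /= !evX -{1}(subnK (_ : n <= m)%N); last lia.
by rewrite exprD; field; rewrite G'0 expf_neq0.
Qed.

(** Elements of the valuation ring are fractions with a unit denominator, so the chain and quotient
    rules write their differentials as integral combinations of ds and du. *)
Lemma vge_derivation x : vge v 0 x -> exists a b, [/\ vge v 0 a, vge v 0 b &
  forall D, is_derivation c D -> D x = a * D s + b * D u].
Proof.
move=> /vge_gen[F [G [-> G0 vG]]].
have [F1 [F2 FD]] := derivation_ev c s u F.
have [G1 [G2 GD]] := derivation_ev c s u G.
have vu := residually_transcendental_vge tu.
have vs0 : vge v 0 s by rewrite vge_neq0 ?vs.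
have vev H : vge v 0 (ev c s u H) by apply: vge_ev.
have vdiv x' : vge v 0 x' -> vge v 0 (x' / ev c s u G ^+ 2).
  by move=> vx; rewrite -[0]addr0 vgeM // vge_neq0 ?invr_eq0 ?expf_neq0 // valV ?expf_neq0 // valX // vG.
have vM x' y' : vge v 0 x' -> vge v 0 y' -> vge v 0 (x' * y').
  by move=> ? ?; rewrite -[0]addr0 vgeM.
exists ((ev c s u F1 * ev c s u G - ev c s u F * ev c s u G1) / ev c s u G ^+ 2).
exists ((ev c s u F2 * ev c s u G - ev c s u F * ev c s u G2) / ev c s u G ^+ 2).
split; try by apply: vdiv; apply: vgeB => //; apply: vM.
by move=> D DD; rewrite (derivation_div _ DD) // (FD _ DD) (GD _ DD); field.
Qed.

(** Thus ds /\ du generates the 2-forms regular along the divisor. *)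
Lemma vge_bracket x y : vge v 0 x -> vge v 0 y ->
  exists2 a, vge v 0 a & bracket x y = a * bracket s u.
Proof.
move=> /vge_derivation[a [b [va vb E]]] /vge_derivation[a' [b' [va' vb' E']]].
exists (a * b' - b * a'); first by apply: vgeB => //; rewrite -[0]addr0 vgeM.
by rewrite /bracket (E _ HD0) (E _ HD1) (E' _ HD0) (E' _ HD1); ring.
Qed.

End Generators.

(* The order of a 2-form with logarithmic poles is at least -1. *)
Lemma vge_logbracket t kappa :
  t != 0 -> v t = 1 -> 
  (forall x y, vge v 0 x -> vge v 0 y -> vge v (- kappa) (bracket x y)) ->
  forall x y, x != 0 -> y != 0 -> vge v (- kappa - 1) (logbracket x y).
Proof.
move=> t0 vt Hk x y x0 y0.
have split_t z : z != 0 -> exists z', [/\ z' != 0, v z' = 0 & z = t ^ v z * z'].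
  move=> z0; exists (z / t ^ v z).
  have tz0 : t ^ v z != 0 by rewrite expfz_neq0.
  rewrite mulf_neq0 ?invr_eq0 // valM ?invr_eq0 // valV // valZ // vt mulr1 subrr.
  by rewrite mulrC divfK.
have [x' [x'0 vx' ->]] := split_t x x0; have [y' [y'0 vy' ->]] := split_t y y0.
move: (v x) (v y) => m n.
(* Since dt/t /\ dt/t = 0, each term contains dt/t at most once and costs at most one pole beyond
   [kappa]. *)
have lgE : logbracket (t ^ m * x') (t ^ n * y') =
    m%:~R * logbracket t y' + n%:~R * logbracket x' t + logbracket x' y'.
  rewrite !logbracketE !(derivationM HD0) ?expfz_neq0 //.
  rewrite !(derivationM HD1) ?expfz_neq0 //.
  by rewrite !(derivationZ _ HD0) // !(derivationZ _ HD1) //; ring.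
have vint z : vge v 0 z%:~R.
  have : vge v 0 (c z%:~R) by apply: vgeC.
  by rewrite rmorph_int.
have vunit z : z != 0 -> v z = 0 -> vge v 0 z^-1.
  by move=> z0 vz; rewrite vge_neq0 ?invr_eq0 // valV // vz.
have vtV : vge v (- 1) t^-1 by rewrite vge_neq0 ?invr_eq0 // valV // vt.
rewrite lgE /logbracket; apply: vgeD => //; first apply: vgeD => //.
- rewrite -[X in vge _ X]add0r; apply: vgeM => //; apply: vgeM => //.
    by apply: Hk; rewrite vge_neq0 ?vt ?vy'.
  by rewrite invfM -[- 1]addr0 vgeM // vunit.
- rewrite -[X in vge _ X]add0r; apply: vgeM => //; apply: vgeM => //.
    by apply: Hk; rewrite vge_neq0 ?vt ?vx'.
  by rewrite invfM -[- 1]add0r vgeM // vunit.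
- apply: (@vge_le _ _ _ (- kappa + 0)); first lia.
  apply: vgeM => //; first by apply: Hk; rewrite vge_neq0 ?vx' ?vy'.
  by apply: vunit; rewrite ?mulf_neq0 // valM // vx' vy'.
Qed.

End Residues.

(** * Inversion of adjunction *)

Section InversionOfAdjunction.
Variables (k : closedFieldType) (K : fieldType) (c : {rmorphism k -> K}) (v : K -> int).
Hypotheses (Hv : is_valuation v) (Hc : forall x, x != 0 -> v (c x) = 0).
Variables D0 D1 : K -> K.
Hypotheses (HD0 : is_derivation c D0) (HD1 : is_derivation c D1).
Variable kappa : int.
Hypothesis Hlog : forall x y, x != 0 -> y != 0 ->
  vge v (- kappa - 1) (logbracket D0 D1 x y).
Notation bracket := (bracket D0 D1).

Lemma ev_translate s u x (F : {poly {poly k}}) :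
  ev c s (u - c x) (map_poly (fun q => q \Po ('X + x%:P)) F) = ev c s u F.
Proof.
have H := @poly2_rmorph_eq k K (ev c s (u - c x) \o map_poly (comp_poly ('X + x%:P))) (ev c s u).
apply: H => [y||] /=.
- by rewrite map_polyC /= comp_polyC !evC !ev1C.
- by rewrite map_polyX !evX.
- by rewrite map_polyC /= comp_polyX !evC rmorphD /= !ev1X ev1C subrK.
Qed.

Lemma bracket_subC s u x : bracket s (u - c x) = bracket s u.
Proof.
have [A0 _ C0] := HD0; have [A1 _ C1] := HD1.
by rewrite /bracket -rmorphN A0 A1 C0 C1 !addr0.
Qed.

Lemma bracketMl s u : bracket s (s * u) = s * bracket s u.
Proof.
have [_ M0 _] := HD0; have [_ M1 _] := HD1.
by rewrite /bracket M0 M1; ring.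
Qed.

Lemma bracketMr s u : bracket (u * s) u = u * bracket s u.
Proof.
have [_ M0 _] := HD0; have [_ M1 _] := HD1.
by rewrite /bracket M0 M1; ring.
Qed.

Lemma bracket0r s : bracket s 0 = 0.
Proof.
have [_ _ C0] := HD0; have [_ _ C1] := HD1.
have := C0 0; have := C1 0; rewrite rmorph0 /bracket => -> ->; ring.
Qed.

(* If kappa = k_E, then kappa + 1 + v (bracket s u) is the log discrepancy of E
   over the plane with coordinates s and u. *)
Lemma log_discrepancy_ge s u : s != 0 -> u != 0 -> bracket s u != 0 ->
  v s + v u <= kappa + 1 + v (bracket s u).
Proof.
move=> s0 u0 b0.
have L0 : logbracket D0 D1 s u != 0 by rewrite /logbracket mulf_neq0 ?invr_eq0 ?mulf_neq0.
have := Hlog s0 u0; rewrite vge_neq0 // (bracket_log D0 D1 s0 u0).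
by rewrite (valM Hv L0 (mulf_neq0 s0 u0)) (valM Hv s0 u0); lia.
Qed.

(* If the curve F = 0 meets X = 0 at the center of v with multiplicity at most
   j, then the pair (X = 0) + (1/j)(F = 0) is log canonical there.  Blow up the
   center of v and induct on its log discrepancy. *)
Lemma inversion_of_adjunction s u (F : {poly {poly k}}) j n :
  vge v 1 s -> vge v 1 u -> bracket s u != 0 -> F`_0`_j != 0 ->
  vge v n (ev c s u F) -> n <= j%:Z * (kappa + 1 + v (bracket s u) - v s).
Proof.
(* The log discrepancy is at least v(s) + v(u) > 0, so its absolute value serves as induction
   measure. *)
have [N] := ubnP (absz (kappa + 1 + v (bracket s u))).
elim: N => // N IH in s u F j n *.
move=> leN vs vu b0 Fj vF.
have s0 : s != 0.
  by apply: contraNneq b0 => ->; rewrite bracketC bracket0r oppr0.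
have u0 : u != 0 by apply: contraNneq b0 => ->; rewrite bracket0r.
have {}vs : 1 <= v s by rewrite -vge_neq0.
have {}vu : 1 <= v u by rewrite -vge_neq0.
have := log_discrepancy_ge s0 u0 b0.
have [A AE] : {A : int | A = kappa + 1 + v (bracket s u)} by eexists.
rewrite -AE in leN * => leA.
have [le|lt] := leP (v s) (v u).
  (* The chart u = s z of the blow-up. Its exceptional curve s = 0 takes over the role of the line X
     = 0. *)
  pose z := u / s.
  have uE : u = s * z by rewrite mulrC divfK.
  have z0 : z != 0 by rewrite mulf_neq0 ?invr_eq0.
  have vz : vge v 0 z.
    by rewrite vge_neq0 // (valM Hv) ?invr_eq0 // (valV Hv) // subr_ge0.
  pose F1 : {poly {poly k}} := ev (@polyCC k) 'X ('X * 'Y) F.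
  have F1E : ev c s z F1 = ev c s u F.
    by rewrite ev_comp rmorphM /= evX evY -uE.
  have F1j : F1`_j`_j != 0 by rewrite coef_blowup leqnn subnn.
  have F10 : F1 != 0 by apply: contraNneq F1j => ->; rewrite !coef0.
  (* [m] is the multiplicity of [F] at the point and [G] its strict transform, whose restriction to
     the exceptional curve has degree at most [m]. *)
  have [m [G [FG G0 GE]]] := poly_order F10.
  have mj : (m <= j)%N.
    by rewrite leqNgt; apply: contra F1j => lt; rewrite FG coefXnM lt coef0.
  have bz : bracket s z != 0.
    by apply: contraNneq b0 => bz; rewrite uE bracketMl bz mulr0.
  (* Over the blow-up the log discrepancy drops by the value of the exceptional curve. *)
  have bzE : kappa + 1 + v (bracket s z) = A - v s.
    by rewrite AE [in RHS]uE bracketMl (valM Hv) //; clear; lia.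
  have sizeG : (size (G`_0)%R <= m.+1)%N.
    rewrite GE; apply/leq_sizeP => i lti.
    by rewrite coef_blowup leqNgt lti.
  have evE : ev c s u F = s ^+ m * ev c s z G.
    by rewrite -F1E FG rmorphM rmorphXn /= evX.
  (* If the center is the whole exceptional curve, then [G] has value 0 and v(s) <= v(u) <= A - v(s)
     gives the bound at once. *)
  have [[x vx]|tz] := residue_cases Hv Hc vz; last first.
    have vs1 : vge v 1 s by rewrite vge_neq0.
    have [e0 ve] := ev_unit Hv Hc vs1 tz G0.
    move: vF; rewrite evE vge_neq0 ?mulf_neq0 ?expf_neq0 //.
    rewrite (valM Hv) ?expf_neq0 // (valX Hv) // ve addr0 => le1.
    apply: le_trans le1 (ler_pM _ _ _ _) => //; first exact: le_trans vs.
    by move: le leA; clear; lia.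
  pose G1 : {poly {poly k}} := map_poly (fun q => q \Po ('X + x%:P)) G.
  have G1E : G1`_0 = G`_0 \Po ('X + x%:P) by rewrite coef_map_id0 ?comp_poly0.
  have sizeG1 : size G1`_0 = size G`_0.
    by rewrite G1E size_comp_poly2 ?size_XaddC.
  have G10 : G1`_0 != 0 by rewrite -size_poly_eq0 sizeG1 size_poly_eq0.
  have bx : bracket s (z - c x) != 0 by rewrite bracket_subC.
  have x0 : z - c x != 0 by apply: contraNneq bx => ->; rewrite bracket0r.
  have := log_discrepancy_ge s0 x0 bx; rewrite bracket_subC bzE => leA'.
  have {}vx : 1 <= v (z - c x) by rewrite -vge_neq0.
  have : n - m%:Z * v s <=
      (size G1`_0).-1%:Z * (kappa + 1 + v (bracket s (z - c x)) - v s).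
    apply: (IH s (z - c x) G1).
    - by rewrite bracket_subC bzE; clear -leN leA vs vu; lia.
    - by rewrite vge_neq0.
    - by rewrite vge_neq0.
    - exact: bx.
    - by rewrite -lead_coefE lead_coef_eq0.
    rewrite ev_translate.
    have -> : ev c s z G = s ^- m * ev c s u F by rewrite evE mulKf ?expf_neq0.
    rewrite addrC vgeM //.
    by rewrite vge_neq0 ?invr_eq0 ?expf_neq0 // (valV Hv) ?expf_neq0 // (valX Hv).
  rewrite bracket_subC bzE sizeG1.
  (* The degree of [G] on the exceptional curve is a crude bound for its local intersection number
     there; being at most [m], it suffices once m v(s) is added back. *)
  have : ((size (G`_0)%R).-1 <= m)%N by rewrite -subn1 leq_subLR add1n.
  move: (_.-1) => i im le1.
  have le2 : i%:Z * (A - v s - v s) <= m%:Z * (A - v s - v s).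
    by apply: ler_wpM2r => //; clear -leA' vx im; lia.
  have le3 : m%:Z * (A - v s) <= j%:Z * (A - v s) by apply: ler_wpM2r => //; clear -leA vu mj; lia.
  by apply: le_trans le3; move: (le_trans le1 le2); rewrite !mulrBr; clear; lia.
have [F00|F00] := eqVneq F`_0`_0 0; last first.
  have vs1 : vge v 1 s by rewrite vge_neq0.
  have vu1 : vge v 1 u by rewrite vge_neq0.
  have [e0 ve] := ev_unit0 Hv Hc vs1 vu1 F00.
  move: vF; rewrite vge_neq0 // ve => n0; apply: le_trans n0 _.
  by rewrite mulr_ge0 //; clear -leA vu; lia.
(* Here v(u) < v(s), and the center lies on the strict transform z = 0 of the line. A single factor
   u is removed from F, whatever its multiplicity, which lowers [j] by one. *)
pose z := s / u.
have sE : s = u * z by rewrite mulrC divfK.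
have z0 : z != 0 by rewrite mulf_neq0 ?invr_eq0.
have vz : v z = v s - v u by rewrite (valM Hv) ?invr_eq0 // (valV Hv).
have bz : bracket z u != 0.
  by apply: contraNneq b0 => bz; rewrite sE bracketMr bz mulr0.
have bzE : kappa + 1 + v (bracket z u) = A - v u.
  by rewrite AE [in RHS]sE bracketMr (valM Hv) //; clear; lia.
have [G FE] := poly_split F; have [q qE] := poly_split F`_0.
rewrite F00 polyC0 add0r in qE.
pose F1 : {poly {poly k}} := q%:P + 'X * ev (@polyCC k) ('X * 'Y) 'Y G.
have F1E : ev c s u F = u * ev c z u F1.
  rewrite {1}FE qE !rmorphD !rmorphM /= ev_comp !rmorphM /= !evX evY !evC ev1X.
  by rewrite [z * u]mulrC -sE mulrDr mulrA -sE.
case: j Fj => [|j] Fj; first by rewrite F00 eqxx in Fj.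
have : n - v u <= j%:Z * (kappa + 1 + v (bracket z u) - v z).
  apply: (IH z u F1) => //.
  - by rewrite bzE; clear -leN leA vs vu; lia.
  - by rewrite vge_neq0 // vz; clear -lt; lia.
  - by rewrite vge_neq0.
  - rewrite /F1 coefD coefC coefXM addr0 /=.
    by move: Fj; rewrite qE coefXM.
  have -> : ev c z u F1 = u^-1 * ev c s u F by rewrite F1E mulKf.
  by rewrite addrC vgeM // vge_neq0 ?invr_eq0 // (valV Hv).
rewrite bzE vz (_ : A - v u - (v s - v u) = A - v s); last by clear; lia.
by rewrite intS mulrDl mul1r; clear -leA; lia.
Qed.

End InversionOfAdjunction.

(** * Partial derivatives on the field of fractions *)

HB.instance Definition _ (k : fieldType) (N : nat) :=
  GRing.RMorphism.copy (@constK k N) (@FracField.tofrac _ \o @mpoly.mpolyC N k).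

Lemma quotient_ruleD (F : fieldType) (x y z t x' y' z' t' : F) : y != 0 -> t != 0 ->
  ((x' * t + x * t' + (z' * y + z * y')) * (y * t) -
   (x * t + z * y) * (y' * t + y * t')) / (y * t) ^+ 2 =
  (x' * y - x * y') / y ^+ 2 + (z' * t - z * t') / t ^+ 2.
Proof. by move=> y0 t0; field; rewrite y0 t0. Qed.

Lemma quotient_ruleM (F : fieldType) (x y z t x' y' z' t' : F) : y != 0 -> t != 0 ->
  ((x' * z + x * z') * (y * t) - x * z * (y' * t + y * t')) / (y * t) ^+ 2 =
  (x' * y - x * y') / y ^+ 2 * (z / t) + x / y * ((z' * t - z * t') / t ^+ 2).
Proof. by move=> y0 t0; field; rewrite y0 t0. Qed.

Section FractionDerivation.
Variable R : idomainType.
Notation tofrac := (@FracField.tofrac R).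

Lemma fraction_reprE (x : {fraction R}) : x = tofrac \n_(repr x) / tofrac \d_(repr x).
Proof.
unlock FracField.tofrac; rewrite -[X in _ * X]FracField.pi_inv -[RHS]FracField.pi_mul.
rewrite /FracField.mulf /FracField.invf !numden_Ratio ?oner_neq0 ?denom_ratioP //.
by rewrite mulr1 mul1r Ratio_numden reprK.
Qed.

Lemma fraction_ex (x : {fraction R}) : exists f g, g != 0 /\ x = tofrac f / tofrac g.
Proof.
by exists \n_(repr x), \d_(repr x); split; [exact: denom_ratioP|exact: fraction_reprE].
Qed.

Variable d : R -> R.
Hypotheses (dD : forall x y, d (x + y) = d x + d y).
Hypotheses (dM : forall x y, d (x * y) = d x * y + x * d y).

Definition fraction_derivation (x : {fraction R}) : {fraction R} :=
  let n := \n_(repr x) in let m := \d_(repr x) in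
  (tofrac (d n) * tofrac m - tofrac n * tofrac (d m)) / tofrac m ^+ 2.

(** Independence of the chosen representative: [d] is applied to the cross-multiplied equality of
    the two fractions. *)
Lemma fraction_derivationE f g : g != 0 ->
  fraction_derivation (tofrac f / tofrac g) =
  (tofrac (d f) * tofrac g - tofrac f * tofrac (d g)) / tofrac g ^+ 2.
Proof.
move=> g0; have := fraction_reprE (tofrac f / tofrac g).
rewrite /fraction_derivation; set x := tofrac f / _.
move: \n_(repr x) \d_(repr x) (denom_ratioP (repr x)) => n m m0 /eqP.
have tg0 : tofrac g != 0 by rewrite tofrac_eq0.
have tm0 : tofrac m != 0 by rewrite tofrac_eq0.
rewrite eqr_div // -!tofracM tofrac_eq => /eqP E.
have dE : d f * m + f * d m = d n * g + n * d g by rewrite -!dM E.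
apply/eqP; rewrite eqr_div ?expf_neq0 // -!tofracXn -!tofracB -!tofracM tofrac_eq.
apply/eqP; rewrite !mulrBl !expr2.
have -> : d n * m * (g * g) = (d n * g) * (m * g) by ring.
have -> : d n * g = d f * m + f * d m - n * d g by rewrite dE addrK.
have -> : n * d m * (g * g) = (n * g) * (d m * g) by ring.
rewrite -E; have -> : (d f * m + f * d m - n * d g) * (m * g) =
  d f * m * (m * g) + f * d m * (m * g) - n * g * (d g * m) by ring.
by rewrite -E; ring.
Qed.

Lemma fraction_derivation1 : d 1 = 0.
Proof. by apply: (addrI (d 1)); rewrite addr0 -{3}[1]mulr1 dM mulr1 mul1r. Qed.

Lemma fraction_derivation_tofrac f : fraction_derivation (tofrac f) = tofrac (d f).
Proof.
rewrite -[tofrac f]divr1 -tofrac1 fraction_derivationE ?oner_neq0 //.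
by rewrite fraction_derivation1 tofrac0 tofrac1 mulr0 subr0 mulr1 expr1n divr1.
Qed.

Lemma fraction_derivationD x y :
  fraction_derivation (x + y) = fraction_derivation x + fraction_derivation y.
Proof.
have [f [g [g0 ->]]] := fraction_ex x; have [f' [g' [g'0 ->]]] := fraction_ex y.
have tg0 : tofrac g != 0 by rewrite tofrac_eq0.
have tg'0 : tofrac g' != 0 by rewrite tofrac_eq0.
rewrite addf_div // -!tofracM -tofracD !fraction_derivationE ?mulf_neq0 //.
by rewrite dD !dM !(tofracD, tofracM) quotient_ruleD.
Qed.

Lemma fraction_derivationM x y : fraction_derivation (x * y) =
  fraction_derivation x * y + x * fraction_derivation y.
Proof.
have [f [g [g0 ->]]] := fraction_ex x; have [f' [g' [g'0 ->]]] := fraction_ex y.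
have tg0 : tofrac g != 0 by rewrite tofrac_eq0.
have tg'0 : tofrac g' != 0 by rewrite tofrac_eq0.
rewrite mulf_div -!tofracM !fraction_derivationE ?mulf_neq0 //.
by rewrite !dM !(tofracD, tofracM) quotient_ruleM.
Qed.

End FractionDerivation.

Section PolynomialRing.
Variables (k : fieldType) (N : nat).

Lemma fracderiv_derivation (i : 'I_N) :
  is_derivation (@constK k N) (@fracderiv k N i).
Proof.
have dD := mpoly.mderivD (R := k) i; have dM := mpoly.mderivM (R := k) i.
split=> [x y|x y|x].
- exact: (fraction_derivationD dD dM).
- exact: (fraction_derivationM dM).
- have := fraction_derivation_tofrac dM (mpoly.mpolyC N x).
  by rewrite mpoly.mderivC tofrac0.
Qed.

Lemma fracderiv_poly (i : 'I_N) f : fracderiv i (toK f) = toK (mpoly.mderiv i f) :> funfield k N.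
Proof. exact: (fraction_derivation_tofrac (mpoly.mderivM (R := k) i)). Qed.

End PolynomialRing.

(** * Valuations of prime divisors *)

Section Localization.
Variables (K : fieldType) (B P : set K).
Hypotheses (B0 : B 0) (B1 : B 1).
Hypotheses (BD : forall x y, B x -> B y -> B (x + y)).
Hypotheses (BM : forall x y, B x -> B y -> B (x * y)).
Hypothesis BP : is_height_one_prime B P.
Hypothesis Bgen : forall x, exists a b, [/\ B a, B b, b != 0 & x = a / b].

Definition localization : set K :=
  [set x | exists a b, [/\ B a, B b, ~ P b & x = a / b]]%classic.

Definition localization_max : set K :=
  [set x | exists a b, [/\ P a, B b, ~ P b & x = a / b]]%classic.

Notation O := localization.
Notation M := localization_max.

Lemma BP_prime : is_prime_of B P.
Proof. by have [] := BP. Qed.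

Lemma prime_neq0 b : ~ P b -> b != 0.
Proof. by have [_ P0 _ _ _] := BP_prime; move=> nPb; apply/eqP => b0; rewrite b0 in nPb. Qed.

Lemma locB x : B x -> O x.
Proof.
have [_ _ _ _ [nP1 _]] := BP_prime.
by move=> Bx; exists x, 1; split=> //; rewrite divr1.
Qed.

Lemma not_primeM a b : B a -> B b -> ~ P a -> ~ P b -> ~ P (a * b).
Proof. by have [_ _ _ _ [_ H]] := BP_prime; move=> Ba Bb nPa nPb /(H _ _ Ba Bb)[]. Qed.

Lemma locM x y : O x -> O y -> O (x * y).
Proof.
move=> [a [b [Ba Bb nPb ->]]] [a' [b' [Ba' Bb' nPb' ->]]].
exists (a * a'), (b * b'); split; [exact: BM|exact: BM|exact: not_primeM|].
by rewrite mulf_div.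
Qed.

Lemma locD x y : O x -> O y -> O (x + y).
Proof.
move=> [a [b [Ba Bb nPb ->]]] [a' [b' [Ba' Bb' nPb' ->]]].
exists (a * b' + a' * b), (b * b'); split; [|exact: BM|exact: not_primeM|].
  by apply: BD; apply: BM.
by rewrite addf_div ?prime_neq0.
Qed.

Lemma locmaxE x : O x -> M x \/ x != 0 /\ O x^-1.
Proof.
move=> [a [b [Ba Bb nPb ->]]]; have [Pa|nPa] := pselect (P a).
  by left; exists a, b.
right; rewrite mulf_neq0 ?invr_eq0 ?prime_neq0 //; split=> //.
by exists b, a; rewrite invfM invrK mulrC.
Qed.

Lemma locmax_sub x : M x -> O x.
Proof.
have [PB _ _ _ _] := BP_prime.
by move=> [a [b [/PB Ba Bb nPb ->]]]; exists a, b.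
Qed.

Lemma locmaxB x : B x -> M x -> P x.
Proof.
have [_ _ _ _ [_ Pprime]] := BP_prime.
move=> Bx [a [b [Pa Bb nPb xE]]].
have : P (x * b) by rewrite xE divfK // prime_neq0.
by move=> /(Pprime _ _ Bx Bb)[].
Qed.

Lemma locmax_prime x : P x -> M x.
Proof.
have [_ _ _ _ [nP1 _]] := BP_prime.
by move=> Px; exists x, 1; split=> //; rewrite divr1.
Qed.

Lemma locmax1 : ~ M 1.
Proof. 
have [_ _ _ _ [nP1 _]] := BP_prime.
by move=> /(locmaxB B1).
Qed.

(** The last clause normalizes [v]: its value group is the full group of integers. *)
Definition has_valuation (v : K -> int) : Prop :=
  [/\ is_valuation v, forall x, O x <-> vge v 0 x, forall x, M x <-> vge v 1 x
    & exists2 t, t != 0 & v t = 1].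

Section Uniformizer.
Variable t : K.
Hypothesis Ut : M = [set t * u | u in O]%classic.

Let MtP x : M x <-> exists2 u, O u & x = t * u.
Proof. by rewrite Ut; split=> [[u Ou <-]|[u Ou ->]]; exists u. Qed.

Let t0 : t != 0.
Proof.
apply/eqP => tz; have [[PB P0 _ _ _] + _] := BP; apply.
apply/seteqP; split=> x /=; last by move=> ->.
by move=> /locmax_prime/MtP[u _ ->]; rewrite tz mul0r.
Qed.

Let not_unit u w : O u -> O w -> t * u * w <> 1.
Proof.
move=> Ou Ow E1; apply: locmax1; apply/MtP.
by exists (u * w); [exact: locM|rewrite mulrA].
Qed.

Let is_unit u := [/\ u != 0, O u & O u^-1].

Let unitM u w : is_unit u -> is_unit w -> is_unit (u * w).
Proof.
move=> [u0 Ou Ou'] [w0 Ow Ow'].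
split.
exact: (mulf_neq0 u0 w0).
exact: (locM Ou Ow).
rewrite invfM.
exact: (locM Ou' Ow').
Qed.

Let unitV u : is_unit u -> is_unit u^-1.
Proof. by move=> [u0 Ou Ou']; split; rewrite ?invr_eq0 ?invrK. Qed.

Let level x n : O x -> ~ (exists2 u, O u & x = t ^+ n * u) ->
  exists m u, is_unit u /\ x = t ^+ m * u.
Proof.
move=> Ox; elim: n => [|n IH] H; first by case: H; exists x; rewrite ?mul1r.
have [[u Ou xE]|/IH//] := pselect (exists2 u, O u & x = t ^+ n * u).
have [Mu|[u0 Ou']] := locmaxE Ou; last by exists n, u.
case: H; have [w Ow uE] := (MtP u).1 Mu.
by exists w => //; rewrite xE uE exprSr mulrA.
Qed.

Let expt_local (m : nat) : O (t ^+ m).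
Proof.
elim: m => [|m IH]; first by rewrite expr0; apply: locB; exact: B1.
rewrite exprS; apply: locM => //; apply: locmax_sub; apply/MtP.
by exists 1; [apply: locB; exact: B1|rewrite mulr1].
Qed.

Let expt_unit (n : int) u : is_unit u -> t ^ n * u = 1 -> n = 0.
Proof.
have neg (m : nat) w : is_unit w -> t ^+ m.+1 * w <> 1.
  move=> [_ Ow _]; rewrite exprS -mulrA.
  have Otm := expt_local m.
  by rewrite mulrA; apply: not_unit.
move=> uu; case: n => [[|m]|m] // E1; first by case: (neg m u uu).
case: (neg m u^-1 (unitV uu)); have [u0 _ _] := uu.
have -> : t ^+ m.+1 = u.
  by rewrite -[RHS](mulVKf (expf_neq0 m.+1 t0)) exprnN -NegzE E1 mulr1.
by rewrite divff.
Qed.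

(** The elements of [B] divisible by all powers of [t] form a prime ideal inside [P], which by
    height one is zero or [P]. If it were [P], then in t = a/b with a in [P] the numerator would be
    divisible by t^2, hence b by t, although b lies outside [P]. *)
Let separated x : B x -> (forall n, exists2 u, O u & x = t ^+ n * u) -> x = 0.
Proof.
pose Q : set K := [set x | B x /\ forall n, exists2 u, O u & x = t ^+ n * u]%classic.
move=> Bx Hx; suff QE : Q = [set 0]%classic by have : Q x by []; rewrite QE.
have QP : (Q `<=` P)%classic.
  move=> y [By /(_ 1%N)[u Ou yE]]; apply: locmaxB => //.
  by apply/MtP; exists u.
have Qprime : is_prime_of B Q.
  split=> [y []//||y z [By Hy] [Bz Hz]|y z By [Bz Hz]|].
  - split=> [|n]; first exact: B0.
    by exists 0; rewrite ?mulr0 //; apply: locB; exact: B0.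
  - split=> [|n]; first exact: BD.
    have [u Ou ->] := Hy n; have [w Ow ->] := Hz n.
    by exists (u + w); [exact: locD|rewrite mulrDr].
  - split=> [|n]; first exact: BM.
    have [w Ow ->] := Hz n; exists (y * w); last by rewrite mulrCA.
    by apply: locM => //; exact: locB.
  split=> [/QP|y z By Bz [Byz Hyz]]; first by have [_ _ _ _ []] := BP_prime.
  have [Qy|nQy] := pselect (Q y); [by left|right].
  split=> // n; apply: contrapT => Hn.
  have [m [u [uu zE]]] := level (locB Bz) Hn.
  have [m' [w [uw yE]]] : exists m u, is_unit u /\ y = t ^+ m * u.
    have /existsNP[n' /level] : ~ forall n, exists2 u, O u & y = t ^+ n * u.
      by move=> H; apply: nQy.
    by apply; apply: locB.
  have [r Or yzE] := Hyz (m' + m).+1.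
  have [uwu0 _ Ouw] := unitM uw uu.
  apply: (@not_unit r (w * u)^-1) => //.
  apply: (mulIf uwu0); rewrite mulfVK // mul1r.
  by apply: (mulfI (expf_neq0 (m' + m) t0)); rewrite mulrA -exprSr -yzE yE zE exprD mulrACA.
have [_ _ /(_ Q Qprime QP)[//|QeqP]] := BP.
have [a [b [Pa Bb nPb tE]]] : M t.
  by apply/MtP; exists 1; rewrite ?mulr1 //; apply: locB; exact: B1.
rewrite -QeqP in Pa; have [_ /(_ 2)[u Ou aE]] := Pa.
have b0 := prime_neq0 nPb.
case: nPb; apply: locmaxB => //; apply/MtP; exists u => //.
by apply: (mulfI t0); rewrite mulrA -expr2 -aE {1}tE divfK.
Qed.

Let expt_ex x : x != 0 -> exists (n : int) u, is_unit u /\ x = t ^ n * u.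
Proof.
have H f : B f -> f != 0 -> exists m u, is_unit u /\ f = t ^+ m * u.
  move=> Bf f0; have /existsNP[n] : ~ forall n, exists2 u, O u & f = t ^+ n * u.
    by move=> /(separated Bf)/eqP; rewrite (negPf f0).
  by move=> /level; apply; apply: locB.
have [f [g [Bf Bg g0 ->]]] := Bgen x => fg0.
have f0 : f != 0 by apply: contraNneq fg0 => ->; rewrite mul0r.
have [m [u [uu ->]]] := H f Bf f0; have [n [w [uw ->]]] := H g Bg g0.
exists (m%:Z - n%:Z), (u / w); split; first by apply: unitM => //; exact: unitV.
by rewrite expfzDr // -exprnN mulf_div.
Qed.

(** By [separated], every nonzero element of [B] is a power of [t] times a unit; the exponent,
    extended to fractions, is the valuation. *)
Lemma uniformizer_valuation : exists v, has_valuation v.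
Proof.
have [v vP] : exists v : K -> int, forall x, x != 0 -> exists u, is_unit u /\ x = t ^ v x * u.
  have /choice[v vP] : forall x, exists n : int, x != 0 -> exists u, is_unit u /\ x = t ^ n * u.
    by move=> x; have [->|/expt_ex[n ?]] := eqVneq x 0; [exists 0|exists n].
  by exists v.
have v_uniq x (n : int) u : is_unit u -> x = t ^ n * u -> v x = n.
  move=> uu xE; have [u0 _ _] := uu.
  have x0 : x != 0 by rewrite xE mulf_neq0 // expfz_neq0.
  have [w [uw xE']] := vP x x0.
  apply/eqP; rewrite -subr_eq0; apply/eqP.
  apply: (@expt_unit _ (w / u)); first by apply: unitM => //; exact: unitV.
  by rewrite expfzDr // -invr_expz mulf_div -xE' -xE divff.
have unit1 : is_unit 1.
  by split; rewrite ?oner_eq0 ?invr1 //; apply: locB; exact: B1.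
have vt : v t = 1 by apply: (v_uniq _ _ 1) => //; rewrite expr1z mulr1.
have vM x y : x != 0 -> y != 0 -> v (x * y) = v x + v y.
  move=> x0 y0; have [u [uu xE]] := vP x x0; have [w [uw yE]] := vP y y0.
  apply: (v_uniq _ _ (u * w)); first exact: unitM.
  by rewrite {1}xE {1}yE expfzDr // mulrACA.
have vO x : O x <-> vge v 0 x.
  have [->|x0] := eqVneq x 0.
    by split=> _; [exact: vge0|apply: locB; exact: B0].
  have [u [uu xE]] := vP x x0; have [u0 Ou Ou'] := uu; rewrite vge_neq0 //.
  rewrite {1}xE; case: (v x) xE => m xE; split=> //.
    by move=> _; apply: locM => //; exact: expt_local.
  move=> OxE; case: (@not_unit (t ^+ m) (t ^ Negz m * u * u^-1)) => //.
    exact: locM.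
  by rewrite mulfK // -exprS NegzE -exprnN divff // expf_neq0.
have vZ n : v (t ^ n) = n.
  by apply: (v_uniq _ _ 1) => //; rewrite mulr1.
have vOn n x : vge v n x <-> O (t ^ (- n) * x).
  have [->|x0] := eqVneq x 0.
    by rewrite mulr0; split=> _; [apply: locB; exact: B0|exact: vge0].
  rewrite vO !vge_neq0 ?mulf_neq0 ?expfz_neq0 // vM ?expfz_neq0 // vZ.
  by rewrite addrC subr_ge0.
exists v; split=> //; last by exists t.
  split=> // n x y /vOn Ox /vOn Oy; apply/vOn; rewrite mulrDr; exact: locD.
move=> x; rewrite vOn MtP; split=> [[u Ou ->]|Ox].
  by rewrite mulrA exprN1 mulVf // mul1r.
by exists (t ^ (- 1) * x) => //; rewrite mulrA exprN1 mulfV // mul1r.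
Qed.

End Uniformizer.

Section Valuation.
Variable v : K -> int.
Hypothesis Ev : has_valuation v.

Lemma valuation_uniformizer t :
  M = [set t * u | u in O]%classic <-> t != 0 /\ v t = 1.
Proof.
have [Hv Ov Mv [s s0 vs]] := Ev.
have Mideal t' : t' != 0 -> v t' = 1 -> M = [set t' * u | u in O]%classic.
  move=> t0 vt; apply/seteqP; split=> x.
    move=> /Mv vx; exists (x / t'); last by rewrite mulrC divfK.
    apply/Ov; rewrite -(subrr 1) vgeM //.
    by rewrite vge_neq0 ?invr_eq0 // (valV Hv) // vt.
  move=> [u /Ov vu <-]; apply/Mv; rewrite -[1]addr0 vgeM //.
  by rewrite vge_neq0 // vt.
split=> [Ut|[]]; last exact: Mideal.
have : M s by apply/Mv; rewrite vge_neq0 ?vs.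
rewrite Ut => -[u /Ov vu sE].
have t0 : t != 0 by apply: contraNneq s0 => t0; rewrite -sE t0 mul0r.
have u0 : u != 0 by apply: contraNneq s0 => u0; rewrite -sE u0 mulr0.
split=> //; have : M t.
  by rewrite Ut; exists 1; [apply/Ov; rewrite vge_neq0 ?oner_neq0 // (val1 Hv)|rewrite mulr1].
move/Mv; rewrite vge_neq0 // in vu *; rewrite vge_neq0 // => vt.
by apply/eqP; rewrite eq_le vt andbT -vs -sE (valM Hv) // lerDl.
Qed.

Lemma valuation_power n x :
  (exists t u, [/\ M = [set t * u | u in O]%classic, O u & x = t ^ n * u]) <-> vge v n x.
Proof.
have [Hv Ov Mv [s s0 vs]] := Ev.
split=> [[t [u [/valuation_uniformizer[t0 vt] /Ov vu ->]]]|vx].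
  by rewrite -[n]addr0 vgeM // vge_neq0 ?expfz_neq0 // (valZ Hv) // vt mulr1 addr0.
exists s, (x / s ^ n); split; [by apply/valuation_uniformizer|apply/Ov|].
  rewrite -(subrr n) vgeM // vge_neq0 ?invr_eq0 ?expfz_neq0 //.
  by rewrite (valV Hv) ?expfz_neq0 // (valZ Hv) // vs mulr1.
by rewrite mulrC divfK // expfz_neq0.
Qed.

End Valuation.

End Localization.

Section DivisorialValuation.
Variables (k : fieldType) (N : nat) (E : prime_divisor k N).
Notation K := (funfield k N).
Notation B := (pd_ring E).
Notation P := (pd_prime E).

Lemma pd_ring_mmap : exists (m : nat) (g : 'I_m -> K), forall x,
  B x <-> exists q, x = mpoly.mmap (@constK k N) g q.
Proof.
have [[m [g BE]] _] := pd_chart E; exists m, g => x; rewrite BE.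
by split=> [[q _ <-]|[q ->]]; exists q.
Qed.

Lemma pd_ringD x y : B x -> B y -> B (x + y).
Proof.
have [m [g BE]] := pd_ring_mmap.
by move=> /BE[p ->] /BE[q ->]; apply/BE; exists (p + q); rewrite rmorphD.
Qed.

Lemma pd_ringM x y : B x -> B y -> B (x * y).
Proof.
have [m [g BE]] := pd_ring_mmap.
by move=> /BE[p ->] /BE[q ->]; apply/BE; exists (p * q); rewrite rmorphM.
Qed.

Lemma pd_ring_poly f : B (toK f).
Proof. by have [_] := pd_chart E; apply. Qed.

Lemma pd_ring1 : B 1.
Proof. by have := pd_ring_poly 1; rewrite tofrac1. Qed.

Lemma pd_ring0 : B 0.
Proof. by have := pd_ring_poly 0; rewrite tofrac0. Qed.

Lemma pd_ring_gen x : exists a b, [/\ B a, B b, b != 0 & x = a / b].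
Proof.
have [f [g [g0 xE]]] := fraction_ex x; exists (toK f), (toK g).
by split; [exact: pd_ring_poly|exact: pd_ring_poly|rewrite tofrac_eq0|].
Qed.

Definition divisorial (v : K -> int) : Prop := has_valuation B P v.

(* Without a uniformizer valE is -oo everywhere, and the log discrepancy is +oo. *)
Lemma divisorial_or_junk : (forall t, ~ is_uniformizer E t) \/ exists v, divisorial v.
Proof.
have [[t Ut]|nU] := pselect (exists t, is_uniformizer E t); [right|left]; last first.
  by move=> t Ut; apply: nU; exists t.
exact: (uniformizer_valuation pd_ring0 pd_ring1 pd_ringD pd_ringM (pd_height_one E) pd_ring_gen Ut).
Qed.

Variable R : realType.

Lemma valE_junk x : (forall t, ~ is_uniformizer E t) -> valE E R x = -oo%E.
Proof.
move=> nU; rewrite /valE [X in ereal_sup X](_ : _ = set0) ?ereal_sup0 //.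
by apply/seteqP; split=> y // [n [t [u [/nU]]]].
Qed.

Variable v : K -> int.
Hypothesis Ev : divisorial v.

Lemma frac_idealE n x : frac_ideal E n x <-> vge v n x.
Proof. exact: (valuation_power Ev n x). Qed.

Lemma valE_divisorial x : x != 0 -> valE E R x = ((v x)%:~R)%:E.
Proof.
move=> x0; rewrite /valE; apply/eqP; rewrite eq_le; apply/andP; split.
  apply: ge_ereal_sup => y [n /frac_idealE]; rewrite vge_neq0 // => le <-.
  by rewrite lee_fin ler_int.
by apply: ereal_sup_ubound; exists (v x) => //; apply/frac_idealE; rewrite vge_neq0.
Qed.

Lemma valE0 : valE E R 0 = +oo%E.
Proof.
apply/eqP; rewrite -leye_eq leNgt; apply/negP => lt.
have H n : ((n%:~R)%:E <= valE E R 0%R)%E.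
  by apply: ereal_sup_ubound; exists n => //; apply/frac_idealE; exact: vge0.
have : (0%:E <= valE E R 0%R)%E by exact: (H 0).
case E0 : (valE E R 0) lt => [r| |] // _ _.
have [n rn] := nat_gt_ex r.
by have := H n; rewrite E0 lee_fin leNgt rn.
Qed.

Lemma valE_ge n x : ((n%:~R)%:E <= valE E R x)%E = vge v n x.
Proof.
have [->|x0] := eqVneq x 0; first by rewrite valE0 leey vge0.
by rewrite valE_divisorial // lee_fin ler_int vge_neq0.
Qed.

Lemma divisorial_poly f : vge v 0 (toK f).
Proof.
have [_ vO _ _] := Ev.
by apply/vO; apply: (locB pd_ring1 (pd_height_one E)); exact: pd_ring_poly.
Qed.

Lemma divisorial_const x : x != 0 -> v (constK N x) = 0.
Proof.
move=> x0; have [Hv _ _ _] := Ev.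
have := divisorial_poly (mpoly.mpolyC N x); have := divisorial_poly (mpoly.mpolyC N x^-1).
have -> : toK (mpoly.mpolyC N x) = constK N x by [].
have -> : toK (mpoly.mpolyC N x^-1) = (constK N x)^-1.
  by rewrite -[RHS]fmorphV.
rewrite !vge_neq0 ?invr_eq0 ?fmorph_eq0 // (valV Hv) ?fmorph_eq0 //.
by move: (v _) => m; lia.
Qed.

Lemma center_divisorial f : center E f <-> vge v 1 (toK f).
Proof.
have [_ _ vM _] := Ev; split=> [Pf|/vM Mf].
  by apply/vM; exact: (locmax_prime pd_ring1 (pd_height_one E)).
by apply: (locmaxB (pd_height_one E)) => //; exact: pd_ring_poly.
Qed.

End DivisorialValuation.

(** * Toric divisors *)

Section Chart.
Variables (k K : fieldType) (c : {rmorphism k -> K}) (s u : K).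
Hypothesis ev_inj : forall F, ev c s u F = 0 -> F = 0.
Hypothesis gen : forall x, exists F G : {poly {poly k}},
  ev c s u G != 0 /\ x = ev c s u F / ev c s u G.

(** The coordinate ring k[s, u] of a plane, whose line s = 0 will be the divisor. *)
Definition chart : set K := range (ev c s u).
Definition chart_prime : set K := [set ev c s u ('X * F) | F in setT]%classic.

Let ev_eq F G : ev c s u F = ev c s u G -> F = G.
Proof.
move=> E; apply: subr0_eq; apply: ev_inj.
by rewrite evB /= E subrr.
Qed.

Lemma chart_primeP F : chart_prime (ev c s u F) <-> F`_0 = 0.
Proof.
split=> [[G _ /ev_eq <-]|F0]; first by rewrite coefXM /=.
by have [G ->] := poly_split F; exists G; rewrite // F0 add0r.
Qed.

Lemma chart_normal : is_integrally_closed chart.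
Proof.
move=> x q qM qB; have [F [G [G0 xE]]] := gen x.
have [C CE] : exists C, forall i, q`_i = ev c s u (C i).
  have /choice[C CE] : forall i, exists F, q`_i = ev c s u F.
    by move=> i; have [F' _ <-] := qB i; exists F'.
  by exists C.
have GF0 : G != 0 by apply: contraNneq G0 => ->; rewrite ev0.
rewrite /root horner_coef => /eqP rt.
have q1 : (0 < size q)%N by rewrite size_poly_gt0 monic_neq0.
pose n := (size q).-1.
have [|H] := @integral_dvd k F G n C GF0; last first.
  by move=> FH; exists H => //; rewrite xE FH evM mulfK.
have FE1 : ev c s u F = x * ev c s u G by rewrite xE divfK.
apply: ev_inj; rewrite evD evXn rmorph_sum /=.
transitivity (ev c s u G ^+ n * (\sum_(i < size q) q`_i * x ^+ i)); last by rewrite rt mulr0.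
have -> : size q = n.+1 by rewrite prednK.
rewrite big_ord_recr /= -lead_coefE (monicP qM) mul1r mulrDr addrC; congr (_ + _).
  rewrite mulr_sumr; apply: eq_bigr => i _; rewrite !evM !evXn FE1 exprMn CE.
  have -> : ev c s u G ^+ n = ev c s u G ^+ (n - i) * ev c s u G ^+ i.
    by rewrite -exprD subnK // ltnW.
  ring.
by rewrite FE1 exprMn mulrC.
Qed.

(** A nonzero prime inside (s) contains some s^n G with G outside (s), hence s^n, hence s. *)
Lemma chart_height_one : is_height_one_prime chart chart_prime.
Proof.
have B0 : chart 0 by exists 0; rewrite ?ev0.
have P1 : ~ chart_prime 1.
  by rewrite -(evE1 c s u) => /chart_primeP/eqP; rewrite coef1 oner_eq0.
have Pprime : is_prime_of chart chart_prime.
  split=> [x [F _ <-]||x y [F _ <-] [G _ <-]|r x [F _ <-] [G _ <-]|].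
  - by exists ('X * F).
  - by exists 0; rewrite ?mulr0 ?ev0.
  - by exists (F + G); rewrite // mulrDr evD.
  - by exists (F * G) => //; rewrite -evM mulrCA.
  split=> // x y [F _ <-] [G _ <-]; rewrite -evM => /chart_primeP/eqP.
  by rewrite coef0M mulf_eq0 => /orP[]/eqP/chart_primeP; [left|right].
split=> //.
  move=> PE; have : chart_prime (ev c s u 'X) by apply/chart_primeP; rewrite coefX.
  by rewrite PE /= => /ev_inj/eqP; rewrite polyX_eq0.
move=> Q [QB Q0 QD QM [Q1 Qprime]] QP.
have [->|[x [Qx x0]]] : Q = [set 0]%classic \/ exists x, Q x /\ x <> 0.
  have [ex|nex] := pselect (exists x, Q x /\ x <> 0); [by right|left].
  apply/seteqP; split=> x /=; last by move=> ->.
  by move=> Qx; apply: contrapT => x0; apply: nex; exists x.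
  by left.
right; apply/seteqP; split=> //.
have [F _ FE] := QB x Qx.
have F0 : F != 0 by apply/eqP => F0; apply: x0; rewrite -FE F0 ev0.
have [n [G [FG G0 _]]] := poly_order F0.
have Bs m : chart (ev c s u 'X ^+ m) by rewrite -evXn; exists ('X^m).
have : Q (ev c s u 'X ^+ n).
  have : Q (ev c s u 'X ^+ n * ev c s u G) by rewrite -evXn -evM -FG FE.
  move=> /(Qprime _ _ (Bs n) (ex_intro2 _ _ G I erefl))[//|/QP/chart_primeP E].
  by rewrite E eqxx in G0.
elim: n {FG} => [|n IH]; first by rewrite expr0.
rewrite exprS => /(Qprime _ _ (Bs 1) (Bs n))[|/IH//] Qs.
by move=> y [H _ <-]; rewrite mulrC evM; apply: QM => //; exists H.
Qed.

Lemma chart_uniformizer : localization_max chart chart_prime =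
  [set s * x | x in localization chart chart_prime]%classic.
Proof.
apply/seteqP; split=> x.
  move=> [a [b [[F _ <-] Bb nPb ->]]]; exists (ev c s u F / b); last first.
    by rewrite evM evX mulrA.
  by exists (ev c s u F), b; split=> //; exists F.
move=> [y [a [b [[F _ <-] Bb nPb ->]]] <-].
exists (ev c s u ('X * F)), b; split=> //; first by exists F.
by rewrite evM evX mulrA.
Qed.

Lemma chart_transcendental v : has_valuation chart chart_prime v ->
  forall x, u - c x != 0 /\ v (u - c x) = 0.
Proof.
move=> [Hv Ov Mv _] x.
have E : u - c x = ev c s u ('Y - x%:P%:P).
  by rewrite evB /= evY evC ev1C.
have u0 : u - c x != 0.
  apply/negP => /eqP; rewrite E => /ev_inj/eqP.
  by rewrite -polyCB polyC_eq0 polyXsubC_eq0.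
split=> //.
have nP : ~ chart_prime (u - c x).
  by rewrite E => /chart_primeP/eqP; rewrite -polyCB coefC polyXsubC_eq0.
have B1 : chart 1 by exists 1; rewrite ?evE1.
have Bu : chart (u - c x) by rewrite E; exists ('Y - x%:P%:P).
have : localization chart chart_prime (u - c x).
  exact: (locB B1 chart_height_one).
have : localization chart chart_prime (u - c x)^-1.
  by exists 1, (u - c x); rewrite mul1r.
by rewrite !Ov !vge_neq0 ?invr_eq0 // (valV Hv) //; lia.
Qed.

End Chart.

Section MonomialChart.
Variables (k : closedFieldType) (K : fieldType) (c : {rmorphism k -> K}).
Variables (D0 D1 : K -> K).
Hypotheses (HD0 : is_derivation c D0) (HD1 : is_derivation c D1).
Variables (w1 w2 a b : nat).
Hypothesis det1 : (w1 * b = w2 * a + 1)%N.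
Variables x y s u : K.
Hypotheses (s0 : s != 0) (u0 : u != 0).
Hypotheses (xE : x = s ^+ w1 * u ^+ a) (yE : y = s ^+ w2 * u ^+ b).

(** dx/x /\ dy/y equals ds/s /\ du/u times the determinant of the monomial substitution, which is
    1. *)
Lemma monomial_bracket : bracket D0 D1 s u = bracket D0 D1 x y * (s * u / (x * y)).
Proof.
have x0 : x != 0 by rewrite xE mulf_neq0 ?expf_neq0.
have y0 : y != 0 by rewrite yE mulf_neq0 ?expf_neq0.
have -> : bracket D0 D1 x y = logbracket D0 D1 x y * (x * y).
  by rewrite bracket_log.
rewrite bracket_log //; suff -> : logbracket D0 D1 s u = logbracket D0 D1 x y.
  by rewrite -[RHS]mulrA; congr (_ * _); rewrite [RHS]mulrC divfK ?mulf_neq0.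
rewrite !logbracketE xE yE !(derivationM HD0) ?expf_neq0 // !(derivationM HD1) ?expf_neq0 //.
rewrite !(derivationX _ HD0) // !(derivationX _ HD1) //.
have -> : (D0 s / s * (D1 u / u) - D1 s / s * (D0 u / u)) =
  (w1 * b)%:R * (D0 s / s * (D1 u / u) - D1 s / s * (D0 u / u)) -
  (w2 * a)%:R * (D0 s / s * (D1 u / u) - D1 s / s * (D0 u / u)).
  by rewrite -mulrBl det1 natrD addrAC subrr add0r mul1r.
by rewrite !natrM; ring.
Qed.

End MonomialChart.

Definition mx0 (k : comNzRingType) : mpoly.mpoly 2 k := mpoly.mpolyX k (mpoly.mnm1 ord0).
Definition mx1 (k : comNzRingType) : mpoly.mpoly 2 k := mpoly.mpolyX k (mpoly.mnm1 ord_max).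

Lemma ord2_cases (i : 'I_2) : i = ord0 \/ i = ord_max.
Proof. by case: i => -[|[|//]] lt; [left|right]; apply: val_inj. Qed.

Section Eval2.
Variables (k A : comNzRingType) (c : {rmorphism k -> A}) (x y : A).

Definition eval2 : mpoly.mpoly 2 k -> A :=
  locked_with ev_key (mpoly.mmap c (fun i : 'I_2 => if i == ord0 then x else y)).

Fact eval2_is_zmod_morphism : zmod_morphism eval2.
Proof. by move=> p q; rewrite /eval2 unlock; exact: mpoly.mmapB. Qed.
Fact eval2_is_monoid_morphism : monoid_morphism eval2.
Proof. by rewrite /eval2 unlock; split=> [|p q]; rewrite ?rmorph1 ?rmorphM. Qed.
HB.instance Definition _ :=
  GRing.isZmodMorphism.Build (mpoly.mpoly 2 k) A eval2 eval2_is_zmod_morphism.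
HB.instance Definition _ :=
  GRing.isMonoidMorphism.Build (mpoly.mpoly 2 k) A eval2 eval2_is_monoid_morphism.

Lemma eval2_0 : eval2 0 = 0. Proof. exact: rmorph0. Qed.
Lemma eval2D f g : eval2 (f + g) = eval2 f + eval2 g. Proof. exact: rmorphD. Qed.
Lemma eval2B f g : eval2 (f - g) = eval2 f - eval2 g. Proof. exact: rmorphB. Qed.
Lemma eval2M f g : eval2 (f * g) = eval2 f * eval2 g. Proof. exact: rmorphM. Qed.
Lemma eval2Xn f n : eval2 (f ^+ n) = eval2 f ^+ n. Proof. exact: rmorphXn. Qed.
Lemma eval2C z : eval2 (mpoly.mpolyC 2 z) = c z.
Proof. by rewrite /eval2 unlock mpoly.mmapC. Qed.
Lemma eval2X : eval2 (mx0 k) = x.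
Proof. by rewrite /eval2 unlock mpoly.mmapX mpoly.mmap1U. Qed.
Lemma eval2Y : eval2 (mx1 k) = y.
Proof. by rewrite /eval2 unlock mpoly.mmapX mpoly.mmap1U. Qed.

Lemma eval2E f : eval2 f =
  \sum_(m <- mpoly.msupp f) c (mpoly.mcoeff m f) * (x ^+ m ord0 * y ^+ m ord_max).
Proof.
rewrite /eval2 unlock; apply: eq_bigr => m _; congr (_ * _).
rewrite /mpoly.mmap1 big_ord_recr big_ord1 /=.
by rewrite (_ : widen_ord (leqnSn 1) ord0 = ord0 :> 'I_2) //; apply: val_inj.
Qed.

Lemma eval2_unique (h : mpoly.mpoly 2 k -> A) :
  (forall f g, h (f + g) = h f + h g) -> (forall f g, h (f * g) = h f * h g) ->
  (forall z, h (mpoly.mpolyC 2 z) = c z) -> h (mx0 k) = x -> h (mx1 k) = y ->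
  h =1 eval2.
Proof.
move=> hD hM hC hX hY.
have hXn f n : h (f ^+ n) = h f ^+ n.
  elim: n => [|n IH]; last by rewrite !exprS hM IH.
  by rewrite !expr0 -mpoly.mpolyC1 hC rmorph1.
apply: mpoly.mpolyind => [|z m p _ _ IH].
  by rewrite -mpoly.mpolyC0 hC eval2C.
rewrite -mpoly.mul_mpolyC hD hM eval2D eval2M hC eval2C IH; congr (_ * _ + _).
rewrite mpoly.mpolyXE_id big_ord_recr big_ord1 /=.
rewrite (_ : widen_ord (leqnSn 1) ord0 = ord0 :> 'I_2); last exact: val_inj.
by rewrite hM !hXn eval2M !eval2Xn hX hY eval2X eval2Y.
Qed.

End Eval2.

Lemma ev_eval2 (k A : comNzRingType) (c : {rmorphism k -> A}) s u P Q f :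
  ev c s u (eval2 (@polyCC k) P Q f) = eval2 c (ev c s u P) (ev c s u Q) f.
Proof.
have H := @eval2_unique k A c (ev c s u P) (ev c s u Q)
  (fun f => ev c s u (eval2 (@polyCC k) P Q f)).
apply: H => [g h|g h|z||]; rewrite ?eval2D ?evD ?eval2M ?evM ?eval2X ?eval2Y //.
by rewrite eval2C evC ev1C.
Qed.

Lemma eval2_surj (k : comNzRingType) (F : {poly {poly k}}) :
  exists f, F = eval2 (@polyCC k) 'X 'Y f.
Proof.
elim/poly_ind: F => [|F q [f fE]]; first by exists 0; rewrite eval2_0.
have [g gE] : exists g, q%:P = eval2 (@polyCC k) 'X 'Y g.
  elim/poly_ind: q => [|q z [g gE]]; first by exists 0; rewrite eval2_0.
  exists (g * mx1 k + mpoly.mpolyC 2 z).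
  by rewrite eval2D eval2M eval2Y eval2C -gE polyCD polyCM.
by exists (f * mx0 k + g); rewrite eval2D eval2M eval2X -fE -gE.
Qed.

(** * Exponents and monomial changes of coordinates *)

Section Support.
Variable k : comNzRingType.
Notation A := (mpoly.mpoly 2 k).
Implicit Types f g : A.

Definition expo (m : mpoly.multinom 2) : nat * nat := (m ord0, m ord_max).

Lemma expo_inj : injective expo.
Proof.
move=> m n [e0 e1]; apply/mpoly.mnmP => i.
by have [->|->] := ord2_cases i.
Qed.

Definition supp f : set (nat * nat) :=
  [set u | exists2 m, mpoly.mcoeff m f != 0 & expo m = u]%classic.

Lemma supp_ex f : f != 0 -> exists u, supp f u.
Proof.
move=> f0; apply: contrapT => /forallNP H; move/eqP: f0; apply; apply/mpoly.mpolyP => m.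
rewrite mpoly.mcoeff0; apply/eqP/negPn/negP => fm; apply: (H (expo m)); by exists m.
Qed.

(** Pullback along X = s^w_1 u^a_1, Y = s^w_2 u^a_2, with s the outer and u the inner variable: an
    exponent m goes to the bidegree (<w, m>, <a, m>). *)
Definition monomial_map (w a : nat * nat) : A -> {poly {poly k}} :=
  eval2 (@polyCC k) ('X^(w.1) * 'Y ^+ a.1) ('X^(w.2) * 'Y ^+ a.2).

Lemma coef_monomial_map w a f i j : (monomial_map w a f)`_i`_j =
  \sum_(m <- mpoly.msupp f | (wt w (expo m) == i) && (wt a (expo m) == j)) mpoly.mcoeff m f.
Proof.
rewrite /monomial_map eval2E !coef_sum [RHS]big_mkcond; apply: eq_bigr => m _.
rewrite !exprMn -!exprM mulrACA -!exprD /polyCC /= mulrA (mulrC _%:P) -mulrA.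
rewrite -rmorphXn -rmorphM coefXnM coefC /wt /=.
case: (ltngtP i) => [lt|gt|->].
- by rewrite coef0.
- by rewrite subn_eq0 leqNgt gt coef0.
- rewrite subnn eqxx /= coefCM coefXn eq_sym.
  by case: eqP; rewrite ?mulr1 ?mulr0.
Qed.

Section Unimodular.
Variables w a : nat * nat.
Hypothesis det1 : (w.1 * a.2 = w.2 * a.1 + 1)%N.

Lemma wt_inj u v : wt w u = wt w v -> wt a u = wt a v -> u = v.
Proof.
move: det1; rewrite /wt; case: w a u v => w1 w2 [a1 a2] [u1 u2] [v1 v2] /= H E1 E2.
have F1 : u1 = v1.
  have : (u1 * (w1 * a2) + w2 * a1 * v1 = v1 * (w1 * a2) + w2 * a1 * u1)%N by nia.
  by rewrite H; nia.
have F2 : u2 = v2.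
  have : (u2 * (w1 * a2) + w2 * a1 * v2 = v2 * (w1 * a2) + w2 * a1 * u2)%N by nia.
  by rewrite H; nia.
by rewrite F1 F2.
Qed.

Lemma coef_monomial_map_supp f m :
  (monomial_map w a f)`_(wt w (expo m))`_(wt a (expo m)) = mpoly.mcoeff m f.
Proof.
rewrite coef_monomial_map.
have eqm n : (wt w (expo n) == wt w (expo m)) && (wt a (expo n) == wt a (expo m)) = (n == m).
  apply/andP/eqP => [[/eqP e1 /eqP e2]|->]; last by rewrite !eqxx.
  by apply: expo_inj; apply: wt_inj.
under eq_bigl do rewrite eqm.
have [fm|] := boolP (m \in mpoly.msupp f).
  by rewrite -big_filter filter_pred1_uniq ?mpoly.msupp_uniq // big_seq1.
move=> nm; rewrite (mpoly.memN_msupp_eq0 nm) big_seq_cond big1 // => n /andP[nf /eqP nE].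
by rewrite -nE nf in nm.
Qed.

Lemma coef_monomial_map_neq0 f i j : (monomial_map w a f)`_i`_j != 0 ->
  exists u, [/\ supp f u, wt w u = i & wt a u = j].
Proof.
rewrite coef_monomial_map => H; apply: contrapT => /forallNP nex.
move/eqP: H; apply; rewrite big_seq_cond big1 // => m /andP[mf /andP[/eqP wi /eqP aj]].
case: (nex (expo m)); split=> //; exists m => //.
by rewrite -mpoly.mcoeff_msupp.
Qed.

Lemma monomial_map_eq0 f : monomial_map w a f = 0 -> f = 0.
Proof.
move=> E; apply/mpoly.mpolyP => m.
by rewrite -coef_monomial_map_supp E !coef0 mpoly.mcoeff0.
Qed.

(** Distinct exponents go to distinct bidegrees, so nothing cancels and the order along s = 0 is the
    least weight. The constant term of [G] collects the terms of [f] on the face of least weight. *)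
Lemma monomial_map_order f : f != 0 -> exists G : {poly {poly k}},
  [/\ monomial_map w a f = 'X^(minwt (supp f) w) * G, G`_0 != 0 &
      G`_0 = (monomial_map w a f)`_(minwt (supp f) w)].
Proof.
move=> f0; have F0 : monomial_map w a f != 0.
  by apply: contraNneq f0 => /monomial_map_eq0 ->.
have [n [G [FG G0 GE]]] := poly_order F0.
suff <- : n = minwt (supp f) w by exists G.
have : (monomial_map w a f)`_n`_(size G`_0).-1 != 0.
  by rewrite -GE -lead_coefE lead_coef_eq0.
move=> /coef_monomial_map_neq0[u [fu wu _]].
rewrite -wu; apply/esym/minwt_eq => // v [m fm <-].
rewrite wu leqNgt; apply/negP => lt; move/eqP: fm; apply.
by rewrite -coef_monomial_map_supp FG coefXnM lt coef0.
Qed.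

(** A unimodular substitution is an isomorphism of tori, so every [F] becomes a pullback once
    multiplied by a power of the image of XY. *)
Lemma monomial_map_cofinal (F : {poly {poly k}}) : exists n f,
  monomial_map w a f = (monomial_map w a (mx0 k * mx1 k)) ^+ n * F.
Proof.
have mE : monomial_map w a (mx0 k * mx1 k) = 'X^(w.1 + w.2) * 'Y ^+ (a.1 + a.2).
  by rewrite /monomial_map eval2M eval2X eval2Y mulrACA -!exprD.
pose M := monomial_map w a (mx0 k * mx1 k).
pose C (F : {poly {poly k}}) := exists n f, monomial_map w a f = M ^+ n * F.
have CM G H : C G -> C H -> C (G * H).
  move=> [n [f fE]] [m [g gE]]; exists (n + m)%N, (f * g).
  by rewrite /monomial_map eval2M -!/(monomial_map _ _) fE gE exprD mulrACA.
have CD G H : C G -> C H -> C (G + H).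
  move=> [n [f fE]] [m [g gE]].
  exists (n + m)%N, (f * (mx0 k * mx1 k) ^+ m + g * (mx0 k * mx1 k) ^+ n).
  rewrite /monomial_map eval2D !(eval2M _ _ _ f) !(eval2M _ _ _ g) !eval2Xn -!/(monomial_map _ _) -/M fE gE.
  by rewrite mulrDr exprD; congr (_ + _); [rewrite mulrAC|rewrite mulrC mulrA].
have CC z : C (polyCC z).
  by exists 0%N, (mpoly.mpolyC 2 z); rewrite /monomial_map eval2C mul1r.
have CX : C 'X.
  (* From s = X^a_2 / Y^a_1 one gets (XY)^a_1 s = X^(a_1 + a_2); the case of u below is
     analogous. *)
  exists a.1, (mx0 k ^+ (a.1 + a.2)).
  rewrite /M mE /monomial_map eval2Xn eval2X !exprMn -!exprM mulrAC -exprSr.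
  congr ('X^ _ * 'Y ^+ _); move: det1; nia.
have CY : C 'Y.
  exists w.2, (mx1 k ^+ (w.1 + w.2)).
  rewrite /M mE /monomial_map eval2Xn eval2Y !exprMn -!exprM -mulrA -exprSr.
  congr ('X^ _ * 'Y ^+ _); move: det1; nia.
elim/poly_ind: F => [|F q IH]; first exact: (CC 0).
apply: (CD); first exact: CM.
elim/poly_ind: q => [|q z IHq]; first by have := CC 0; rewrite /polyCC /= polyC0.
by rewrite polyCD polyCM; apply: CD; [apply: CM|exact: CC].
Qed.

End Unimodular.
End Support.

Lemma det_mx22 (R : comNzRingType) (f : 'I_2 -> 'I_2 -> R) :
  \det (\matrix_(i, j) f i j) = f ord0 ord0 * f ord_max ord_max - f ord0 ord_max * f ord_max ord0.
Proof.
rewrite (expand_det_row _ ord0) big_ord_recr big_ord1 /= /cofactor !mxE.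
have -> : widen_ord (leqnSn 1) ord0 = ord0 :> 'I_2 by apply: val_inj.
rewrite !det_mx11 !mxE /= expr0 mul1r expr1 mulN1r mulrN.
have -> : lift ord0 ord0 = ord_max :> 'I_2 by apply: val_inj.
by have -> : lift ord_max ord0 = ord0 :> 'I_2 by apply: val_inj.
Qed.

Section SuppMonomial.
Variable k : comNzRingType.

Lemma mcoeff_mx0Xn m n : mpoly.mcoeff m (mx0 k ^+ n) = (expo m == (n, 0%N))%:R.
Proof.
rewrite mpoly.mcoeffXn -(inj_eq expo_inj) eq_sym; congr (_ == _)%:R.
by rewrite /expo !mpoly.mulmnE !mpoly.mnm1E /= mul1n mul0n.
Qed.

Lemma mcoeff_mx1Xn m n : mpoly.mcoeff m (mx1 k ^+ n) = (expo m == (0%N, n))%:R.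
Proof.
rewrite mpoly.mcoeffXn -(inj_eq expo_inj) eq_sym; congr (_ == _)%:R.
by rewrite /expo !mpoly.mulmnE !mpoly.mnm1E /= mul1n mul0n.
Qed.

Lemma expo_surj (u : nat * nat) : exists m, expo m = u.
Proof.
exists (mpoly.mnm_add (mpoly.mnm_muln (mpoly.mnm1 ord0) u.1) (mpoly.mnm_muln (mpoly.mnm1 ord_max) u.2)).
rewrite /expo !mpoly.mnmDE !mpoly.mulmnE !mpoly.mnm1E /=.
by case: u => ? ?; rewrite /= !mul1n !mul0n addn0.
Qed.

Lemma minwt_supp_mx0 w : minwt (supp (mx0 k)) w = w.1.
Proof.
have [m mE] := expo_surj (1, 0)%N.
rewrite (@minwt_eq _ _ (1, 0)%N); first by rewrite /wt /= muln1 muln0 addn0.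
  by exists m => //; rewrite -[mx0 k]expr1 mcoeff_mx0Xn mE eqxx oner_neq0.
move=> _ [n + <-]; rewrite -[mx0 k]expr1 mcoeff_mx0Xn.
by case: (expo n =P _) => [->//|]; rewrite eqxx.
Qed.

Lemma minwt_supp_mx1 w : minwt (supp (mx1 k)) w = w.2.
Proof.
have [m mE] := expo_surj (0, 1)%N.
rewrite (@minwt_eq _ _ (0, 1)%N); first by rewrite /wt /= muln1 muln0.
  by exists m => //; rewrite -[mx1 k]expr1 mcoeff_mx1Xn mE eqxx oner_neq0.
move=> _ [n + <-]; rewrite -[mx1 k]expr1 mcoeff_mx1Xn.
by case: (expo n =P _) => [->//|]; rewrite eqxx.
Qed.

Lemma mx0_neq0 : mx0 k != 0.
Proof.
apply/eqP => /(congr1 (mpoly.mcoeff (mpoly.mnm1 ord0))).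
by rewrite mpoly.mcoeffX eqxx mpoly.mcoeff0 => /eqP; rewrite oner_eq0.
Qed.

Lemma mx1_neq0 : mx1 k != 0.
Proof.
apply/eqP => /(congr1 (mpoly.mcoeff (mpoly.mnm1 ord_max))).
by rewrite mpoly.mcoeffX eqxx mpoly.mcoeff0 => /eqP; rewrite oner_eq0.
Qed.

(** This is the numerator of u - z for u = Y^w_1 / X^w_2; both of its possible exponents have the
    same weight. *)
Lemma minwt_supp_binomial (w : nat * nat) z : (0 < w.1)%N ->
  let f := mx1 k ^+ w.1 - mpoly.mpolyC 2 z * mx0 k ^+ w.2 in
  f != 0 /\ minwt (supp f) w = (w.1 * w.2)%N.
Proof.
move=> w1 f; have [m mE] := expo_surj (0%N, w.1).
have fE n : mpoly.mcoeff n f = (expo n == (0%N, w.1))%:R - z * (expo n == (w.2, 0%N))%:R.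
  by rewrite mpoly.mcoeffB mpoly.mcoeffCM mcoeff_mx0Xn mcoeff_mx1Xn.
have fm : mpoly.mcoeff m f != 0.
  rewrite fE mE eqxx xpair_eqE (gtn_eqF w1) andbF mulr0 subr0; exact: oner_neq0.
split; first by apply: contraNneq fm => ->; rewrite mpoly.mcoeff0.
rewrite (@minwt_eq _ _ (0%N, w.1)); first by rewrite /wt muln0 mulnC.
  by exists m.
move=> _ [n + <-]; rewrite fE /wt.
case: (expo n =P (0%N, _)) => [->//|_]; case: (expo n =P _) => [-> _|_].
  by rewrite !muln0 add0n addn0 mulnC.
by rewrite mulr0 subr0 eqxx.
Qed.

End SuppMonomial.

Section ToricChart.
Variables (k : closedFieldType) (K : fieldType) (c : {rmorphism k -> K}).
Variables x y : K.
Hypothesis xy_inj : forall f, eval2 c x y f = 0 -> f = 0.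
Hypothesis xy_gen : forall z, exists f g,
  eval2 c x y g != 0 /\ z = eval2 c x y f / eval2 c x y g.

Let x0 : x != 0.
Proof.
apply: contraNneq (mx0_neq0 k) => xE; apply/eqP/xy_inj.
by rewrite eval2X.
Qed.

Let y0 : y != 0.
Proof.
apply: contraNneq (mx1_neq0 k) => yE; apply/eqP/xy_inj.
by rewrite eval2Y.
Qed.

Section Weight.
Variables w a : nat * nat.
Hypothesis det1 : (w.1 * a.2 = w.2 * a.1 + 1)%N.

(** [chart_s] and [chart_u] invert the substitution of [monomial_map]: the former is an equation of
    the toric divisor, the latter a coordinate along it. *)
Definition chart_s := x ^+ a.2 / y ^+ a.1.
Definition chart_u := y ^+ w.1 / x ^+ w.2.
Notation s := chart_s.
Notation u := chart_u.

Lemma chart_s_neq0 : s != 0.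
Proof. by rewrite mulf_neq0 ?invr_eq0 ?expf_neq0. Qed.

Lemma chart_u_neq0 : u != 0.
Proof. by rewrite mulf_neq0 ?invr_eq0 ?expf_neq0. Qed.

Lemma chart_xE : x = s ^+ w.1 * u ^+ a.1.
Proof.
rewrite /chart_s /chart_u !exprMn !exprVn -!exprM (mulnC a.2) det1 (mulnC a.1 w.1).
by rewrite exprD expr1; field; rewrite !expf_neq0.
Qed.

Lemma chart_yE : y = s ^+ w.2 * u ^+ a.2.
Proof.
rewrite /chart_s /chart_u !exprMn !exprVn -!exprM det1 (mulnC a.2) (mulnC a.1).
by rewrite exprD expr1; field; rewrite !expf_neq0.
Qed.

Lemma ev_monomial_map f : eval2 c x y f = ev c s u (monomial_map w a f).
Proof.
rewrite /monomial_map ev_eval2 !evM !evXn evX evY.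
by congr (eval2 c _ _ f); [exact: chart_xE|exact: chart_yE].
Qed.

Lemma ev_chart_inj F : ev c s u F = 0 -> F = 0.
Proof.
move=> F0; have [n [f fE]] := monomial_map_cofinal det1 F.
have /xy_inj f0 : eval2 c x y f = 0 by rewrite ev_monomial_map fE evM F0 mulr0.
have m0 : monomial_map w a (mx0 k * mx1 k) != 0.
  apply/negP => /eqP E; have := ev_monomial_map (mx0 k * mx1 k).
  by rewrite E ev0 eval2M eval2X eval2Y => /eqP; rewrite mulf_eq0 (negPf x0) (negPf y0).
move/eqP: fE; rewrite f0 /monomial_map eval2_0 eq_sym mulf_eq0 expf_eq0.
by rewrite -!/(monomial_map _ _) (negPf m0) andbF /= => /eqP.
Qed.

Lemma ev_chart_gen z : exists F G, ev c s u G != 0 /\ z = ev c s u F / ev c s u G.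
Proof.
have [f [g [g0 ->]]] := xy_gen z.
by exists (monomial_map w a f), (monomial_map w a g); rewrite -!ev_monomial_map.
Qed.

Lemma chart_bracket D0 D1 : is_derivation c D0 -> is_derivation c D1 ->
  bracket D0 D1 x y = 1 -> bracket D0 D1 s u = s * u / (x * y).
Proof.
move=> H0 H1 E; rewrite (monomial_bracket H0 H1 det1 chart_s_neq0 chart_u_neq0 chart_xE chart_yE).
by rewrite E mul1r.
Qed.

Variable v : K -> int.
Hypotheses (Hv : is_valuation v) (Hc : forall z, z != 0 -> v (c z) = 0).

(** The factor [d] allows for nontoric valuations, whose pair of values at X and Y need not be
    primitive. *)
Lemma val_chart (d : int) : v x = d * w.1%:Z -> v y = d * w.2%:Z -> v s = d /\ v u = 0.
Proof.
move=> vx vy; rewrite /chart_s /chart_u !(valM Hv) ?invr_eq0 ?expf_neq0 //.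
rewrite !(valV Hv) ?expf_neq0 // !(valX Hv) // vx vy.
have E : w.1%:Z * a.2%:Z = w.2%:Z * a.1%:Z + 1 by move: det1; clear; lia.
split; last by ring.
have -> : a.2%:Z * (d * w.1%:Z) - a.1%:Z * (d * w.2%:Z) =
  d * (w.1%:Z * a.2%:Z - w.2%:Z * a.1%:Z) by ring.
by rewrite E addrAC subrr add0r mulr1.
Qed.

Lemma val_chart_bracket D0 D1 : is_derivation c D0 -> is_derivation c D1 ->
  bracket D0 D1 x y = 1 -> bracket D0 D1 s u != 0 /\
  v (bracket D0 D1 s u) = v s + v u - v x - v y.
Proof.
move=> H0 H1 E; rewrite chart_bracket //.
have s0 := chart_s_neq0; have u0 := chart_u_neq0.
have su0 := mulf_neq0 s0 u0; have xy0 := mulf_neq0 x0 y0.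
have xyV0 : (x * y)^-1 != 0 by rewrite invr_eq0; exact: xy0.
split; first exact: mulf_neq0 su0 xyV0.
rewrite (valM Hv su0 xyV0) (valV Hv xy0) (valM Hv s0 u0) (valM Hv x0 y0).
by clear; lia.
Qed.

(** When the center is the whole line s = 0, the strict transform [G] is a unit and only the power
    of s contributes. *)
Lemma toric_val f : vge v 1 s -> residually_transcendental c v u -> f != 0 ->
  v (eval2 c x y f) = (minwt (supp f) w)%:Z * v s.
Proof.
move=> vs tu f0; have [G [fE G0 _]] := monomial_map_order det1 f0.
have [e0 ve] := ev_unit Hv Hc vs tu G0; have s0 := chart_s_neq0.
rewrite ev_monomial_map fE evM evXn evX (valM Hv) ?expf_neq0 // (valX Hv) // ve.
by rewrite addr0.
Qed.

(** A toric valuation takes its monomial value on Y^w_1 - z X^w_2 for every constant z, so no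
    constant is the residue of u. *)
Lemma toric_transcendental :
  (forall f, f != 0 -> v (eval2 c x y f) = minwt (supp f) w) ->
  residually_transcendental c v u.
Proof.
move=> tor z.
have w1 : (0 < w.1)%N.
  by rewrite lt0n; apply/eqP => w0; move: det1; rewrite w0 mul0n addn1.
have [f0 mf] := minwt_supp_binomial z w1.
have vx : v x = w.1 by rewrite -(eval2X c x y) tor ?mx0_neq0 // minwt_supp_mx0.
have := tor _ f0; rewrite mf; set f := mx1 k ^+ _ - _ in f0 * => vf.
have ef0 : eval2 c x y f != 0 by apply: contraNneq f0 => /xy_inj ->.
have uE : u - c z = eval2 c x y f / x ^+ w.2.
  rewrite eval2B eval2M !eval2Xn eval2X eval2Y eval2C.
  by rewrite mulrBl mulfK ?expf_neq0.
rewrite uE mulf_neq0 ?invr_eq0 ?expf_neq0 //; split=> //.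
rewrite (valM Hv) ?invr_eq0 ?expf_neq0 // (valV Hv) ?expf_neq0 // (valX Hv) // vf vx.
by clear; lia.
Qed.

End Weight.
End ToricChart.

(** * The discrepancy of a divisor over the plane *)

Section Plane.
Variable k : closedFieldType.
Notation K := (funfield k 2).
Notation cK := (@constK k 2).
Notation xK := (toK (mx0 k) : K).
Notation yK := (toK (mx1 k) : K).
Notation D0 := (@fracderiv k 2 ord0).
Notation D1 := (@fracderiv k 2 ord_max).

Lemma toK_eval2 f : toK f = eval2 cK xK yK f.
Proof.
apply: (@eval2_unique k K cK xK yK (fun f => toK f)) => //.
  exact: tofracD.
exact: tofracM.
Qed.

Lemma plane_inj f : eval2 cK xK yK f = 0 -> f = 0.
Proof. by rewrite -toK_eval2 => /eqP; rewrite tofrac_eq0 => /eqP. Qed.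

Lemma plane_gen z : exists f g,
  eval2 cK xK yK g != 0 /\ z = eval2 cK xK yK f / eval2 cK xK yK g.
Proof.
have [f [g [g0 zE]]] := fraction_ex z; exists f, g.
by rewrite -!toK_eval2 tofrac_eq0.
Qed.

Lemma plane_bracket : bracket D0 D1 xK yK = 1.
Proof.
rewrite /bracket !fracderiv_poly /mx0 /mx1 !mpoly.mderivX !mpoly.mnm1E /=.
rewrite !scale1r !scale0r !tofrac0 mulr0 subr0 -tofracM.
have U0 (i : 'I_2) : mpoly.mpolyX k (mpoly.mnm_sub (mpoly.mnm1 i) (mpoly.mnm1 i)) = 1.
  rewrite -mpoly.mpolyX0; congr (mpoly.mpolyX k _); apply/mpoly.mnmP => j.
  by rewrite mpoly.mnmBE subnn mpoly.mnm0E.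
by rewrite !U0 mulr1 tofrac1.
Qed.

Lemma jacobianE (f : 'I_2 -> K) : jacobian f = bracket D0 D1 (f ord0) (f ord_max).
Proof. by rewrite /jacobian det_mx22. Qed.

Section ExistsToric.
Variables w a : nat * nat.
Hypothesis det1 : (w.1 * a.2 = w.2 * a.1 + 1)%N.
Notation s := (chart_s xK yK a).
Notation u := (chart_u xK yK w).

Lemma toric_chart : is_chart (chart cK s u).
Proof.
split=> [|f]; last first.
  exists (monomial_map w a f) => //.
  by rewrite toK_eval2 (ev_monomial_map plane_inj det1).
exists 2, (fun i : 'I_2 => if i == ord0 then s else u).
have E f : mpoly.mmap cK (fun i : 'I_2 => if i == ord0 then s else u) f = eval2 cK s u f.
  by rewrite /eval2 unlock.
apply/seteqP; split=> z [F _ <-].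
  have [f ->] := eval2_surj F; exists f => //.
  by rewrite E ev_eval2 evX evY.
by exists (eval2 (@polyCC k) 'X 'Y F) => //; rewrite E ev_eval2 evX evY.
Qed.

Definition toric_divisor : prime_divisor k 2 :=
  PrimeDivisor toric_chart
    (chart_normal (ev_chart_inj plane_inj det1) (ev_chart_gen plane_inj plane_gen det1))
    (chart_height_one (ev_chart_inj plane_inj det1)).

Lemma toric_divisor_val : exists v, divisorial toric_divisor v /\
  forall f, f != 0 -> v (toK f) = minwt (supp f) w.
Proof.
have Us : is_uniformizer toric_divisor s by exact: (chart_uniformizer cK s u).
have [/(_ s)//|[v Ev]] := divisorial_or_junk toric_divisor.
have [Hv _ Mv _] := Ev.
have [s0 vs] := (valuation_uniformizer Ev s).1 Us.
have tu := chart_transcendental (ev_chart_inj plane_inj det1) Ev.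
have vs1 : vge v 1 s by rewrite vge_neq0 // vs.
exists v; split=> // f f0.
rewrite toK_eval2 (toric_val plane_inj det1 Hv (divisorial_const Ev) vs1 tu f0).
by rewrite vs mulr1.
Qed.

End ExistsToric.

Variable R : realType.

Section Discrepancy.
Variables (E : prime_divisor k 2) (v : K -> int).
Hypothesis Ev : divisorial E v.

Let Ov z : local_ring E z <-> vge v 0 z.
Proof. by have [_ H _ _] := Ev; exact: H. Qed.

Lemma kE_attained kappa f g :
  (forall f g, vge v 0 f -> vge v 0 g -> vge v (- kappa) (bracket D0 D1 f g)) ->
  vge v 0 f -> vge v 0 g -> bracket D0 D1 f g != 0 -> v (bracket D0 D1 f g) = - kappa ->
  kE E R = (kappa%:~R)%:E.
Proof.
move=> Hk vf vg b0 vb; apply/eqP; rewrite eq_le; apply/andP; split.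
  apply: ge_ereal_sup => _ [h Oh <-]; rewrite jacobianE leeNl -EFinN -rmorphN.
  by rewrite (valE_ge R Ev); apply: Hk; apply/Ov.
pose h (i : 'I_2) := if i == ord0 then f else g.
have Oh i : local_ring E (h i) by rewrite /h; case: ifP => _; apply/Ov.
apply: ereal_sup_ubound; exists h => //.
by rewrite jacobianE /h /= (valE_divisorial R Ev) // vb rmorphN EFinN oppeK.
Qed.

(** The pole orders of brackets are unbounded or attain a maximum, which is nonnegative because X
    and Y have bracket 1. The value +oo is kept as a case: lower bounds for the log discrepancy are
    then immediate. *)
Lemma kE_cases : kE E R = +oo%E \/ exists2 kappa, kE E R = (kappa%:~R)%:E &
  forall f g, vge v 0 f -> vge v 0 g -> vge v (- kappa) (bracket D0 D1 f g).
Proof.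
have [Hv _ _ _] := Ev.
pose bound (n : nat) := `[< forall f g, vge v 0 f -> vge v 0 g -> vge v (- n%:Z) (bracket D0 D1 f g) >].
have unbound n : ~~ bound n -> exists f g, [/\ vge v 0 f, vge v 0 g,
    bracket D0 D1 f g != 0 & v (bracket D0 D1 f g) < - n%:Z].
  move=> /asboolPn/existsNP[f /existsNP[g /not_implyP[vf /not_implyP[vg]]]].
  by rewrite /vge => /negP; rewrite negb_or -ltNge => /andP[]; exists f, g.
have [ex|nex] := pselect (exists n, bound n); [right|left].
  case: (ex_minnP ex) => n /asboolP Hn min; exists n%:Z => //.
  case: n Hn min => [|n] Hn min.
    apply: (kE_attained Hn (divisorial_poly Ev (mx0 k)) (divisorial_poly Ev (mx1 k))).
      by rewrite plane_bracket; exact: oner_neq0.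
    by rewrite plane_bracket (val1 Hv) oppr0.
  have [|f [g [vf vg b0 lt]]] := unbound n.
    by apply/negP => /min; rewrite ltnn.
  apply: (kE_attained Hn vf vg b0).
  have := Hn f g vf vg; rewrite vge_neq0 //; move: lt; clear; lia.
apply/eqP; rewrite -leye_eq leNgt; apply/negP => lt.
have H (n : nat) : ((n%:R)%:E <= kE E R)%E.
  have [|f [g [vf vg b0 ltn]]] := unbound n.
    by apply/negP => bn; apply: nex; exists n.
  pose h (i : 'I_2) := if i == ord0 then f else g.
  have Oh i : local_ring E (h i) by rewrite /h; case: ifP => _; apply/Ov.
  apply: (@le_trans _ _ (- valE E R (jacobian h))%E); last first.
    by apply: ereal_sup_ubound; exists h.
  rewrite jacobianE /h /= (valE_divisorial R Ev) // -EFinN lee_fin -rmorphN.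
  by rewrite -[n%:R]/(n%:Z%:~R) ler_int; move: ltn; clear; lia.
case kEE : (kE E R) lt => [r| |] // _.
  have [n rn] := nat_gt_ex r.
  by have := H n; rewrite kEE lee_fin leNgt rn.
by have := H 0%N; rewrite kEE leeNy_eq.
Qed.

(** ds /\ du generates the 2-forms along the divisor, so the supremum is attained at [s] and [u]. *)
Lemma kE_generators s u : v s = 1 -> s != 0 -> residually_transcendental cK v u ->
  (forall z, exists F G, ev cK s u G != 0 /\ z = ev cK s u F / ev cK s u G) ->
  bracket D0 D1 s u != 0 -> kE E R = ((- v (bracket D0 D1 s u))%:~R)%:E.
Proof.
move=> vs s0 tu gen b0; have [Hv _ _ _] := Ev; have Hc := divisorial_const Ev.
have HD0 := @fracderiv_derivation k 2 ord0.
have HD1 := @fracderiv_derivation k 2 ord_max.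
apply: (@kE_attained _ s u) => //.
- move=> f g vf vg.
  have [z vz ->] := vge_bracket Hv Hc HD0 HD1 vs s0 tu gen vf vg.
  by rewrite opprK; apply: (vgeMl Hv vz); rewrite (vge_neq0 v _ b0).
- by rewrite (vge_neq0 v 0 s0) vs.
- exact: (residually_transcendental_vge tu).
- by rewrite opprK.
Qed.

End Discrepancy.
End Plane.

Section ToricDivisors.
Variables (k : closedFieldType) (R : realType).
Notation K := (funfield k 2).
Notation cK := (@constK k 2).
Notation xK := (toK (mx0 k) : K).
Notation yK := (toK (mx1 k) : K).
Notation D0 := (@fracderiv k 2 ord0).
Notation D1 := (@fracderiv k 2 ord_max).
Implicit Types (E : prime_divisor k 2) (w : nat * nat).

Definition toric_weight E (v : K -> int) w : Prop :=
  divisorial E v /\ forall f, f != 0 -> v (toK f) = minwt (supp f) w.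

Lemma ereal_inf_min (T : Type) (S : set T) (F : T -> R) x :
  S x -> (forall y, S y -> F x <= F y) -> ereal_inf [set (F y)%:E | y in S]%classic = (F x)%:E.
Proof.
move=> Sx Fx; apply/eqP; rewrite eq_le; apply/andP; split.
  by apply: ereal_inf_lbound; exists x.
by apply: le_ereal_inf_tmp => _ [y Sy <-]; rewrite lee_fin; apply: Fx.
Qed.

Lemma toric_inf (w : 'I_2 -> nat) (f : polyring k 2) : f != 0 ->
  ereal_inf [set ((\sum_(i < 2) w i * u i)%N%:R : R)%:E
            | u in [set u : mpoly.multinom 2 | mpoly.mcoeff u f != 0]]%classic =
  ((minwt (supp f) (w ord0, w ord_max))%:R)%:E.
Proof.
move=> f0; have [u [m fm mE] min] := minwt_ex (w ord0, w ord_max) (supp_ex f0).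
have sumE (n : mpoly.multinom 2) : (\sum_(i < 2) w i * n i)%N = wt (w ord0, w ord_max) (expo n).
  rewrite big_ord_recr big_ord1 /=.
  by rewrite (_ : widen_ord (leqnSn 1) ord0 = ord0 :> 'I_2) //; apply: val_inj.
rewrite min -mE -sumE.
apply: (@ereal_inf_min _ _ (fun n : mpoly.multinom 2 => (\sum_(i < 2) w i * n i)%N%:R)) => // n fn.
by rewrite ler_nat !sumE mE -min minwt_le //; exists n.
Qed.

(** All values would be multiples of [d], but a uniformizer has value 1. *)
Lemma toric_weight_dvd E v w d : toric_weight E v w -> (d %| w.1)%N -> (d %| w.2)%N -> d = 1%N.
Proof.
move=> [Ev tor] d1 d2; have [Hv _ _ [t t0 vt]] := Ev.
have dvd f : f != 0 -> exists n : nat, v (toK f) = (n * d)%N.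
  move=> f0; have [u _ mE] := minwt_ex w (supp_ex f0).
  have /dvdnP[n nE] : (d %| minwt (supp f) w)%N by rewrite mE /wt dvdn_add ?dvdn_mulr.
  by exists n; rewrite tor // nE.
have [f [g [g0 tE]]] := fraction_ex t.
have tg0 : toK g != 0 by rewrite tofrac_eq0.
have tf0 : toK f != 0 by apply: contraNneq t0 => f0; rewrite tE f0 mul0r.
have f0 : f != 0 by rewrite -tofrac_eq0.
have tgV0 : (toK g)^-1 != 0 by rewrite invr_eq0; exact: tg0.
move: vt; rewrite tE (valM Hv tf0 tgV0) (valV Hv tg0).
have [m ->] := dvd f f0; have [n ->] := dvd g g0 => mn.
have {}mn : (m * d = n * d + 1)%N by move: mn; clear; lia.
apply/eqP; rewrite -dvdn1 -(dvdn_addr _ (dvdn_mull n (dvdnn d))) -mn.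
exact: dvdn_mull.
Qed.

Lemma is_toric_weight E : is_toric E R -> exists v w, toric_weight E v w /\ coprime w.1 w.2.
Proof.
move=> [w tor].
have {}tor f : f != 0 -> valE E R (toK f) = ((minwt (supp f) (w ord0, w ord_max))%:R)%:E.
  by move=> f0; rewrite tor toric_inf.
have [nU|[v Ev]] := divisorial_or_junk E.
  by have := tor _ (mx0_neq0 k); rewrite valE_junk.
have vw : toric_weight E v (w ord0, w ord_max).
  split=> // f f0; have := tor f f0; rewrite (valE_divisorial R Ev) ?tofrac_eq0 //.
  by move=> [] /eqP; rewrite -[_%:R]/((Posz _)%:~R) eqr_int => /eqP.
exists v, (w ord0, w ord_max); split=> //; apply/eqP.
by apply: (toric_weight_dvd vw); rewrite ?dvdn_gcdl ?dvdn_gcdr.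
Qed.

Lemma toric_weightX E v w : toric_weight E v w -> v xK = w.1 /\ v yK = w.2.
Proof.
by move=> [_ tor]; rewrite !tor ?mx0_neq0 ?mx1_neq0 // minwt_supp_mx0 minwt_supp_mx1.
Qed.

Lemma coprime_det w : coprime w.1 w.2 -> (0 < w.1)%N ->
  exists a, (w.1 * a.2 = w.2 * a.1 + 1)%N.
Proof.
move=> /eqP cop w1; have [km kn E _] := egcdnP w.2 w1.
by exists (kn, km); rewrite /= mulnC E cop mulnC.
Qed.

Lemma toric_weight_kE E v w : toric_weight E v w -> coprime w.1 w.2 ->
  kE E R = ((w.1 + w.2)%:R - 1)%:E.
Proof.
move=> tw cop; have [Ev tor] := tw; have [Hv _ _ _] := Ev.
have [vx vy] := toric_weightX tw; have Hc := divisorial_const Ev.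
have HD0 := @fracderiv_derivation k 2 ord0.
have HD1 := @fracderiv_derivation k 2 ord_max.
(* The determinant condition needs w_1 > 0. For w_1 = 0 coprimality leaves only (0, 1), the line Y =
   0, which is treated in the coordinates (Y, X). *)
have [w1|w1] := posnP w.1; last first.
  have [a det1] := coprime_det cop w1.
  have [vs vu] : v (chart_s xK yK a) = 1 /\ v (chart_u xK yK w) = 0.
    by apply: (val_chart (@plane_inj k) det1 Hv); rewrite mul1r.
  have tor' f : f != 0 -> v (eval2 cK xK yK f) = minwt (supp f) w.
    by rewrite -toK_eval2; exact: tor.
  have tu := toric_transcendental (@plane_inj k) det1 Hv tor'.
  have [b0 vb] := val_chart_bracket (@plane_inj k) det1 Hv HD0 HD1 (plane_bracket k).
  rewrite (kE_generators R Ev vs (chart_s_neq0 (@plane_inj k) a) tu _ b0); last first.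
    exact: (ev_chart_gen (@plane_inj k) (@plane_gen k) det1).
  congr (_%:E); rewrite vb vs vu vx vy natrD.
  have -> : - (1 + 0 - w.1%:Z - w.2%:Z) = w.1%:Z + w.2%:Z - 1 by clear; lia.
  by rewrite rmorphB rmorphD.
have w2 : w.2 = 1%N by move: cop; rewrite w1 /coprime gcd0n => /eqP.
have x0 : xK != 0 by rewrite tofrac_eq0 mx0_neq0.
have y0 : yK != 0 by rewrite tofrac_eq0 mx1_neq0.
rewrite w1 w2 in vx vy.
have tx : residually_transcendental cK v xK.
  move=> z; pose f := mx0 k - mpoly.mpolyC 2 z.
  have [m mE] := expo_surj (1, 0)%N.
  have fm : mpoly.mcoeff m f != 0.
    rewrite mpoly.mcoeffB -[mx0 k]expr1 mcoeff_mx0Xn mE eqxx mpoly.mcoeffC.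
    have -> : (m == @mpoly.mnm0 2) = false.
      by apply/eqP => m0; move: mE; rewrite m0 /expo !mpoly.mnm0E.
    by rewrite mulr0 subr0 oner_neq0.
  have f0 : f != 0 by apply: contraNneq fm => ->; rewrite mpoly.mcoeff0.
  have mf : minwt (supp f) w = 0%N.
    apply/eqP; rewrite -leqn0 (leq_trans (@minwt_le _ w (1, 0)%N _)) //.
      by exists m.
    by rewrite /wt w1 mul0n muln0.
  have <- : toK f = xK - cK z by exact: tofracB.
  by rewrite tofrac_eq0 tor // mf.
have bE : bracket D0 D1 yK xK = -1 by rewrite bracketC plane_bracket.
have b0 : bracket D0 D1 yK xK != 0 by rewrite bE oppr_eq0 oner_neq0.
rewrite (kE_generators R Ev vy y0 tx _ b0).
  by rewrite bE (valN Hv) (val1 Hv) oppr0 w1 w2 add0n subrr.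
move=> z; have [f [g [g0 ->]]] := plane_gen z.
pose F h : {poly {poly k}} := eval2 (@polyCC k) ('Y : {poly {poly k}}) 'X h.
by exists (F f), (F g); rewrite !ev_eval2 evX evY.
Qed.

End ToricDivisors.

(** * Bounding values by the faces of the Newton polygon *)

Lemma poly_translate_coef (k : idomainType) (q : {poly k}) (z : k) i r :
  z != 0 -> q`_i != 0 ->
  (forall l, (l < i)%N -> q`_l = 0) -> (forall l, (i + r < l)%N -> q`_l = 0) ->
  exists2 j, (j <= r)%N & (q \Po ('X + z%:P))`_j != 0.
Proof.
move=> z0 qi lo hi.
(* Up to the factor X^i, which does not vanish at z, [q] has degree at most [r]; hence it vanishes
   at z to order at most [r]. *)
pose H := drop_poly i q.
have qE : q = H * 'X^i.
  rewrite -[LHS](poly_take_drop i) [X in X + _](_ : _ = 0) ?add0r //.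
  by apply/polyP => l; rewrite coef_take_poly coef0; case: ltnP => // /lo.
have H0 : H != 0.
  by apply: contraNneq qi => HE; rewrite qE HE mul0r coef0.
have sizeH : (size H <= r.+1)%N.
  by apply/leq_sizeP => l rl; rewrite coef_drop_poly hi //; move: rl; clear; lia.
have sizeH' : size (H \Po ('X + z%:P)) = size H by rewrite size_comp_poly2 ?size_XaddC.
have H0' : H \Po ('X + z%:P) != 0 by rewrite -size_poly_eq0 sizeH' size_poly_eq0.
have [j [G [HG G0 _]]] := poly_order H0'.
have G1 : G != 0 by apply: contraNneq G0 => ->; rewrite coef0.
have sizeG : size H = (j + size G)%N by rewrite -sizeH' HG mulrC size_mulXn.
exists j.
  move: sizeH; rewrite sizeG; have : (0 < size G)%N by rewrite size_poly_gt0.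
  by clear; lia.
rewrite qE comp_polyM comp_Xn_poly HG -mulrA coefXnM ltnn subnn.
by rewrite coef0M mulf_neq0 // -horner_coef0 horner_exp hornerD hornerX hornerC add0r expf_neq0.
Qed.

(** [l] is the lattice length of a segment orthogonal to [w], whose ends differ by l (w_2, -w_1). An
    exponent m of at least the same weight satisfies w_1 (m_1 - nx) + w_2 m_2 >= w_1 w_2 l, whence l
    <= m_1 - nx + m_2 because w_1, w_2 >= 1; symmetrically for [ny]. *)
Lemma face_length (w a u0 u1 m : nat * nat) (l nx ny : nat) :
  (w.1 * a.2 = w.2 * a.1 + 1)%N -> pos w ->
  wt w u0 = wt w u1 -> wt a u1 = (wt a u0 + l)%N ->
  (wt w u1 <= wt w m)%N -> 
  (nx <= u1.1)%N -> (nx <= m.1)%N -> (ny <= u0.2)%N -> (ny <= m.2)%N ->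
  (l <= m.1 + m.2 - nx)%N /\ (l <= m.1 + m.2 - ny)%N.
Proof.
case: w a u0 u1 m => w1 w2 [a1 a2] [p0 q0] [p1 q1] [m1 m2].
rewrite /pos /wt /= => det1 /andP[w1_gt0 w2_gt0] Ew Ea le x1 xm y0 ym.
have Ep : (p0 = p1 + w2 * l)%N by nia.
have Eq : (q1 = q0 + w1 * l)%N by nia.
have key A B : (w1 * w2 * l <= w1 * A + w2 * B)%N -> (l <= A + B)%N.
  move=> H; rewrite leqNgt; apply/negP => lt.
  have [w12|w21] := leqP w1 w2; nia.
split.
  have := key (m1 - nx)%N m2; rewrite addnBAC //; apply; nia.
have := key m1 (m2 - ny)%N; rewrite addnBA //; apply; nia.
Qed.

Section ChartBound.
Variables (k : closedFieldType) (K : fieldType) (c : {rmorphism k -> K}).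
Variables x y : K.
Hypothesis xy_inj : forall f, eval2 c x y f = 0 -> f = 0.
Variables w a : nat * nat.
Hypothesis det1 : (w.1 * a.2 = w.2 * a.1 + 1)%N.
Variable v : K -> int.
Hypotheses (Hv : is_valuation v) (Hc : forall z, z != 0 -> v (c z) = 0).
Variables D0 D1 : K -> K.
Hypotheses (HD0 : is_derivation c D0) (HD1 : is_derivation c D1).
Hypothesis D1xy : bracket D0 D1 x y = 1.
Variable kappa : int.
Hypothesis Hlog : forall z t, z != 0 -> t != 0 ->
  vge v (- kappa - 1) (logbracket D0 D1 z t).
Variable d : int.
Hypotheses (d_gt0 : 0 < d) (vx : v x = d * w.1%:Z) (vy : v y = d * w.2%:Z).

(** The log discrepancy of [v] over the plane with coordinates [chart_s] and [chart_u], where [v]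
    takes the values [d] and 0. *)
Notation A := (kappa + 1 + d - d * w.1%:Z - d * w.2%:Z).

Lemma chart_discrepancy_ge : d <= A.
Proof.
have [vs vu] := val_chart xy_inj det1 Hv vx vy.
have [b0 vb] := val_chart_bracket xy_inj det1 Hv HD0 HD1 D1xy.
have := log_discrepancy_ge Hv Hlog (chart_s_neq0 xy_inj a) (chart_u_neq0 xy_inj w) b0.
by rewrite vb vs vu vx vy; clear; lia.
Qed.

(** [r] bounds the length of the face of least weight. If the center of [v] is the whole toric
    divisor, the value is the monomial one. Otherwise it is a point u = z with z nonzero, where the
    strict transform meets the divisor with multiplicity at most [r], and inversion of adjunction
    bounds the excess. *)
Lemma val_chart_le (f : mpoly.mpoly 2 k) r : f != 0 ->
  (forall u0 u1 l, supp f u0 -> supp f u1 -> wt w u0 = minwt (supp f) w ->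
    wt w u1 = minwt (supp f) w -> wt a u1 = (wt a u0 + l)%N -> (l <= r)%N) ->
  v (eval2 c x y f) <= (minwt (supp f) w)%:Z * d + r%:Z * (A - d).
Proof.
move=> f0 span; have leA := chart_discrepancy_ge.
have rA0 : 0 <= r%:Z * (A - d) by apply: mulr_ge0 => //; rewrite subr_ge0.
have [vs vu] := val_chart xy_inj det1 Hv vx vy.
have s0 := chart_s_neq0 xy_inj a; have u0 := chart_u_neq0 xy_inj w.
have vs1 : vge v 1 (chart_s x y a) by rewrite vge_neq0 // vs.
have vu0 : vge v 0 (chart_u x y w) by rewrite vge_neq0 // vu.
have [[z vz]|tu] := residue_cases Hv Hc vu0; last first.
  by rewrite (toric_val xy_inj det1 Hv Hc vs1 tu f0) vs lerDl.
have z0 : z != 0.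
  by apply: contraTneq vz => ->; rewrite rmorph0 subr0 vge_neq0 // vu.
have [G [fG G0 GE]] := monomial_map_order det1 f0.
have ef0 : eval2 c x y f != 0 by apply: contraNneq f0 => /xy_inj ->.
have exi : exists i, (G`_0)%R`_i != 0.
  by exists (size (G`_0)%R).-1; rewrite -lead_coefE lead_coef_eq0.
case: (ex_minnP exi) => i Gi mini.
have [||j jr Gj] := poly_translate_coef (r := r) z0 Gi.
- by move=> l li; apply/eqP; apply: contraTT li => /mini; rewrite leqNgt.
- move=> l il; apply/eqP; apply: contraTT il => Gl; rewrite -leqNgt.
  have := Gi; rewrite GE => /(coef_monomial_map_neq0)[v0 [fv0 wv0 av0]].
  have := Gl; rewrite GE => /(coef_monomial_map_neq0)[v1 [fv1 wv1 av1]].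
  have le_il := mini l Gl.
  have := span v0 v1 (l - i)%N fv0 fv1 wv0 wv1.
  rewrite av0 av1 subnKC // => /(_ erefl); rewrite leq_subLR.
  by [].
pose G1 : {poly {poly k}} := map_poly (fun q => q \Po ('X + z%:P)) G.
have G1j : (G1`_0)%R`_j != 0 by rewrite coef_map_id0 ?comp_poly0.
have [b0 vb] := val_chart_bracket xy_inj det1 Hv HD0 HD1 D1xy.
have bz := bracket_subC HD0 HD1 (chart_s x y a) (chart_u x y w) z.
have := @inversion_of_adjunction k K c v Hv Hc D0 D1 HD0 HD1 kappa Hlog
  (chart_s x y a) (chart_u x y w - c z) G1 j
  (v (eval2 c x y f) - (minwt (supp f) w)%:Z * d) vs1 vz.
rewrite bz vb vs vu vx vy ev_translate => /(_ b0 G1j) H.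
have {}H : v (eval2 c x y f) - (minwt (supp f) w)%:Z * d <= j%:Z * (A - d).
  apply: (le_trans (H _)); last first.
    by rewrite (_ : kappa + 1 + _ = A) //; clear; lia.
  have -> : ev c (chart_s x y a) (chart_u x y w) G =
      (chart_s x y a ^+ minwt (supp f) w)^-1 * eval2 c x y f.
    by rewrite (ev_monomial_map xy_inj det1) fG evM evXn evX mulKf ?expf_neq0.
  rewrite vge_neq0 ?mulf_neq0 ?invr_eq0 ?expf_neq0 // (valM Hv) ?invr_eq0 ?expf_neq0 //.
  by rewrite (valV Hv) ?expf_neq0 // (valX Hv) // vs addrC.
rewrite addrC -lerBlDr; apply: le_trans H _.
by apply: ler_wpM2r; rewrite ?subr_ge0.
Qed.

End ChartBound.

(** * Log discrepancies and minimal log discrepancies *)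

Section IdealSupport.
Variables (k : comNzRingType).
Implicit Types I : set (mpoly.mpoly 2 k).

Definition ideal_supp I : set (nat * nat) := [set u | exists2 f, I f & supp f u]%classic.

Lemma minwt_ideal I w : (exists u, ideal_supp I u) ->
  exists f, [/\ I f, f != 0 & minwt (supp f) w = minwt (ideal_supp I) w].
Proof.
move=> /(minwt_ex w)[u [f If fu] mu]; exists f; split=> //.
  by case: fu => m fm _; apply: contraNneq fm => ->; rewrite mpoly.mcoeff0.
by rewrite mu; apply: minwt_eq => // v fv; rewrite -mu; apply: minwt_le; exists f.
Qed.

Lemma minwt_ideal_le I w f : I f -> f != 0 -> (minwt (ideal_supp I) w <= minwt (supp f) w)%N.
Proof.
by move=> If /supp_ex/(minwt_ex w)[u fu ->]; apply: minwt_le; exists f.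
Qed.

Lemma ideal_supp_empty I f : ~ (exists u, ideal_supp I u) -> I f -> f = 0.
Proof.
move=> nS If; apply/eqP/negPn/negP => /supp_ex[u fu].
by apply: nS; exists u, f.
Qed.

End IdealSupport.

Section LogDiscrepancy.
Variables (k : closedFieldType) (R : realType) (e : {fset R}) (a : multiideal k 2 e).
Hypothesis he : forall c, c \in e -> 0 < c.
Notation K := (funfield k 2).
Notation cK := (@constK k 2).
Notation xK := (toK (mx0 k) : K).
Notation yK := (toK (mx1 k) : K).
Notation D0 := (@fracderiv k 2 ord0).
Notation D1 := (@fracderiv k 2 ord_max).
Implicit Types (E : prime_divisor k 2) (w : nat * nat).

Definition supports (c : e) := ideal_supp (mi_ideal a c).
Definition exponent (c : e) : R := fsval c.

Lemma exponent_gt0 c : 0 < exponent c. Proof. exact: he (fsvalP c). Qed.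

Lemma ideal0 c : mi_ideal a c 0. Proof. by have [] := mi_idealP a c. Qed.

Lemma val_ideal_toric E v w c : toric_weight E v w -> (exists u, supports c u) ->
  val_ideal E R (mi_ideal a c) = ((minwt (supports c) w)%:R)%:E.
Proof.
move=> [Ev tor] Sc; apply/eqP; rewrite eq_le; apply/andP; split.
  have [f [If f0 mf]] := minwt_ideal w Sc.
  apply: ereal_inf_lbound; exists f => //.
  by rewrite (valE_divisorial R Ev) ?tofrac_eq0 // tor // mf.
apply: le_ereal_inf_tmp => _ [f If <-].
have [->|f0] := eqVneq f 0; first by rewrite tofrac0 (valE0 R Ev) leey.
rewrite (valE_divisorial R Ev) ?tofrac_eq0 // tor // lee_fin.
by rewrite -[X in _ <= X]/((minwt (supp f) w)%:R) ler_nat; exact: minwt_ideal_le.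
Qed.

Lemma log_discrepancy_toric E v w : toric_weight E v w -> coprime w.1 w.2 ->
  (forall c, exists u, supports c u) -> log_discrepancy a E = (tdisc exponent supports w)%:E.
Proof.
move=> tw cop S0; rewrite /log_discrepancy (toric_weight_kE R tw cop).
under eq_bigr => c _ do rewrite (val_ideal_toric tw (S0 c)) -EFinM.
rewrite sumEFin -EFinB -EFinD; congr (_%:E).
by rewrite /tdisc addrAC subrK.
Qed.

Lemma val_ideal_zero E v c : divisorial E v -> ~ (exists u, supports c u) ->
  val_ideal E R (mi_ideal a c) = +oo%E.
Proof.
move=> Ev nS; apply/eqP; rewrite -leye_eq; apply: le_ereal_inf_tmp => _ [f If <-].
by rewrite (ideal_supp_empty nS If) tofrac0 (valE0 R Ev).
Qed.

Lemma val_ideal_ge0 E v c : divisorial E v -> (0 <= val_ideal E R (mi_ideal a c))%E.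
Proof.
move=> Ev; apply: le_ereal_inf_tmp => _ [f If <-].
by have := valE_ge R Ev 0 (toK f); rewrite (divisorial_poly Ev).
Qed.

Lemma log_discrepancy_zero E v w c : toric_weight E v w -> coprime w.1 w.2 ->
  ~ (exists u, supports c u) -> log_discrepancy a E = -oo%E.
Proof.
move=> tw cop nS; have [Ev _] := tw.
rewrite /log_discrepancy (toric_weight_kE R tw cop) (bigD1 c) //=.
rewrite (val_ideal_zero Ev nS) mulry gtr0_sg ?exponent_gt0 // mul1e.
rewrite addye; last first.
  rewrite gt_eqF //; apply: (@lt_le_trans _ _ 0%E); first exact: ltNyr.
  apply: sume_ge0 => i _; apply: mule_ge0; first by rewrite lee_fin ltW ?exponent_gt0.
  exact: val_ideal_ge0 Ev.
by [].
Qed.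

Lemma log_discrepancy_junk E : (forall t, ~ is_uniformizer E t) ->
  log_discrepancy a E = +oo%E.
Proof.
move=> nU.
have kEy : kE E R = +oo%E.
  apply/eqP; rewrite -leye_eq; apply: ereal_sup_ubound.
  exists (fun=> 0); last by rewrite (valE_junk R _ nU).
  by move=> i; apply: (locB (pd_ring1 E) (pd_height_one E)); exact: pd_ring0.
have vy c : val_ideal E R (mi_ideal a c) = -oo%E.
  apply/eqP; rewrite -leeNy_eq; apply: ereal_inf_lbound.
  by exists 0; [exact: ideal0|exact: valE_junk].
rewrite /log_discrepancy kEy.
suff le0 : (\sum_(c : e) (fsval c)%:E * val_ideal E R (mi_ideal a c) <= 0)%E.
  by move: le0; case: (\sum_(c : e) _)%E.
apply: sume_le0 => c _; rewrite vy mulrNy gtr0_sg ?exponent_gt0 // mul1e.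
Qed.

Lemma log_discrepancy_lower E (b : e -> R) :
  (forall c, (val_ideal E R (mi_ideal a c) <= (b c)%:E)%E) ->
  (kE E R - (\sum_c exponent c * b c)%:E + 1 <= log_discrepancy a E)%E.
Proof.
move=> Hb; apply: leeD2r; apply: leeB => //; rewrite -sumEFin.
by apply: lee_sum => c _; rewrite EFinM lee_pmul2l ?lte_fin ?exponent_gt0.
Qed.

(* The hypothesis says that, away from one of the coordinate axes, the ideals
   have small multiplicity at the origin; by inversion of adjunction a divisor
   centered at a general point of a toric exceptional divisor E_w then has log
   discrepancy at least that of E_w. *)
Lemma log_discrepancy_ge_toric E :
  (forall c, exists u, supports c u) -> (forall w, pos w -> 0 <= tdisc exponent supports w) ->
  tdisc exponent supports (1, 0)%N < tdisc exponent supports (1, 1)%N \/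
  tdisc exponent supports (0, 1)%N < tdisc exponent supports (1, 1)%N ->
  center_at_origin E ->
  exists2 w, pos w & ((tdisc exponent supports w)%:E <= log_discrepancy a E)%E.
Proof.
move=> S0 Sge0 mult cE.
have [nU|[v Ev]] := divisorial_or_junk E.
  by exists (1, 1)%N; rewrite // (log_discrepancy_junk nU) leey.
have [Hv _ _ [t t0 vt]] := Ev; have Hc := divisorial_const Ev.
have center f : mpoly.meval (fun=> 0) f = 0 -> vge v 1 (toK f).
  by move=> f0; apply/(center_divisorial Ev); rewrite cE.
have x0 : xK != 0 by rewrite tofrac_eq0 mx0_neq0.
have y0 : yK != 0 by rewrite tofrac_eq0 mx1_neq0.
have vx : 1 <= v xK.
  by rewrite -(vge_neq0 v 1 x0); apply: center; rewrite mpoly.mevalXU.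
have vy : 1 <= v yK.
  by rewrite -(vge_neq0 v 1 y0); apply: center; rewrite mpoly.mevalXU.
(* The primitive weight [w] with values d w_1 and d w_2 at X and Y singles out the toric divisor on
   which the center of [v] lies. *)
pose d := gcdn `|v xK| `|v yK|.
have d_gt0 : (0 < d)%N by rewrite gcdn_gt0; move: vx; clear; case: (v xK) => [[|n]|n].
pose w : nat * nat := (`|v xK| %/ d, `|v yK| %/ d)%N.
have wx : v xK = d%:Z * w.1%:Z.
  by rewrite -PoszM /= mulnC divnK ?dvdn_gcdl // gez0_abs //; move: vx; clear; lia.
have wy : v yK = d%:Z * w.2%:Z.
  by rewrite -PoszM /= mulnC divnK ?dvdn_gcdr // gez0_abs //; move: vy; clear; lia.
have wpos : pos w.
  rewrite /pos !lt0n; apply/andP; split; apply/eqP => w0.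
    by move: vx; rewrite wx w0 mulr0.
  by move: vy; rewrite wy w0 mulr0.
have [w1 _] := andP wpos.
have cop : coprime w.1 w.2.
  rewrite /coprime -(eqn_pmul2l d_gt0) muln_gcdr muln1 /=.
  by rewrite !(mulnC d) !divnK ?dvdn_gcdl ?dvdn_gcdr.
have [b det1] := coprime_det cop w1.
exists w => //.
(* One element of least weight per ideal suffices: its value bounds that of the ideal from above. *)
have /choice[f fP] : forall c, exists f,
    [/\ mi_ideal a c f, f != 0 & minwt (supp f) w = minwt (supports c) w].
  by move=> c; exact: (minwt_ideal w (S0 c)).
have lower := @log_discrepancy_lower E (fun c => (v (toK (f c)))%:~R).
have {}lower : (kE E R - (\sum_c exponent c * (v (toK (f c)))%:~R)%:E + 1 <= log_discrepancy a E)%E.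
  apply: lower => c; have [If f0 _] := fP c.
  have tf0 : toK (f c) != 0 by rewrite tofrac_eq0.
  apply: ereal_inf_lbound; exists (f c); first exact: If.
  exact: (valE_divisorial R Ev tf0).
have [kEy|[kappa kEk Hk]] := kE_cases R Ev.
  by apply: le_trans lower; rewrite kEy leey.
apply: le_trans lower; rewrite kEk -EFinB -EFinD lee_fin.
have HD0 := @fracderiv_derivation k 2 ord0.
have HD1 := @fracderiv_derivation k 2 ord_max.
have Hlog := vge_logbracket Hv Hc HD0 HD1 t0 vt Hk.
(* [r c] is the multiplicity of the ideal minus its order along one axis; the corresponding case of
   [mult] says that the weighted sum of these differences is less than 1. *)
have [r [r_le1 span]] : exists r : e -> nat, \sum_c exponent c * (r c)%:R <= 1 /\
    forall c u0 u1 l, supp (f c) u0 -> supp (f c) u1 ->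
      wt w u0 = minwt (supp (f c)) w -> wt w u1 = minwt (supp (f c)) w ->
      wt b u1 = (wt b u0 + l)%N -> (l <= r c)%N.
  have face c u0 u1 l : supp (f c) u0 -> supp (f c) u1 ->
      wt w u0 = minwt (supp (f c)) w -> wt w u1 = minwt (supp (f c)) w ->
      wt b u1 = (wt b u0 + l)%N ->
      (l <= minwt (supports c) (1, 1) - minwt (supports c) (1, 0))%N /\
      (l <= minwt (supports c) (1, 1) - minwt (supports c) (0, 1))%N.
    move=> fu0 fu1 wu0 wu1 bu; have [If _ mf] := fP c.
    have Su u : supp (f c) u -> supports c u by move=> fu; exists (f c).
    have [m Sm ->] := minwt_ex (1, 1)%N (S0 c).
    have H10 u : supports c u -> (minwt (supports c) (1, 0) <= u.1)%N.
      by move=> /(minwt_le (1, 0)%N); rewrite /wt /= mul1n mul0n addn0.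
    have H01 u : supports c u -> (minwt (supports c) (0, 1) <= u.2)%N.
      by move=> /(minwt_le (0, 1)%N); rewrite /wt /= mul1n mul0n add0n.
    have -> : wt (1, 1)%N m = (m.1 + m.2)%N by rewrite /wt /= !mul1n.
    apply: (face_length det1 wpos (etrans wu0 (esym wu1)) bu) => //.
    - by rewrite wu1 mf minwt_le.
    - exact/H10/Su.
    - exact: H10.
    - exact/H01/Su.
    - exact: H01.
  have small h : (h.1 + h.2 = 1)%N -> (h.1 <= 1)%N -> (h.2 <= 1)%N ->
      tdisc exponent supports h < tdisc exponent supports (1, 1)%N ->
      \sum_c exponent c * (minwt (supports c) (1, 1) - minwt (supports c) h)%:R <= 1.
    move=> h1 hx hy; rewrite /tdisc h1 /= => lt.
    have -> : \sum_c exponent c * (minwt (supports c) (1, 1) - minwt (supports c) h)%:R =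
        \sum_c exponent c * (minwt (supports c) (1, 1))%:R - \sum_c exponent c * (minwt (supports c) h)%:R.
      rewrite -sumrB; apply: eq_bigr => c _; rewrite natrB ?mulrBr //.
      have [m Sm ->] := minwt_ex (1, 1)%N (S0 c).
      apply: leq_trans (minwt_le h Sm) _; rewrite /wt /=.
      by apply: leq_add; rewrite leq_mul2r ?hx ?hy orbT.
    by move: lt; move: (\sum_c _) (\sum_c _) => p q; lra.
  case: mult => lt.
    exists (fun c => minwt (supports c) (1, 1) - minwt (supports c) (1, 0))%N; split.
      exact: (small (1, 0)%N).
    by move=> c u0 u1 l *; have [] := face c u0 u1 l.
  exists (fun c => minwt (supports c) (1, 1) - minwt (supports c) (0, 1))%N; split.
    exact: (small (0, 1)%N).
  by move=> c u0 u1 l *; have [] := face c u0 u1 l.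
have d_gt0' : (0 : int) < d by [].
have leA := chart_discrepancy_ge (@plane_inj k) det1 Hv HD0 HD1 (plane_bracket k) Hlog wx wy.
have vle c : v (toK (f c)) <= (minwt (supports c) w)%:Z * d%:Z +
    (r c)%:Z * (kappa + 1 - d%:Z * w.1%:Z - d%:Z * w.2%:Z).
  have [_ f0 <-] := fP c.
  have := val_chart_le (@plane_inj k) det1 Hv Hc HD0 HD1 (plane_bracket k) Hlog d_gt0' wx wy f0 (span c).
  rewrite -toK_eval2 (_ : kappa + 1 + d%:Z - d%:Z * w.1%:Z - d%:Z * w.2%:Z - d%:Z =
    kappa + 1 - d%:Z * w.1%:Z - d%:Z * w.2%:Z) //.
  by clear; lia.
(* [B] is the excess A - d in the chart. As the weighted sum of the [r c] is at most 1, a single [B]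
   absorbs all the corrections; what remains is d a(w) >= a(w). *)
have [B [B0 Bint BE]] : exists B : R, [/\ 0 <= B,
    B = (kappa + 1 - d%:Z * w.1%:Z - d%:Z * w.2%:Z)%:~R &
    kappa%:~R + 1 = B + d%:R * (w.1 + w.2)%:R].
  exists (kappa + 1 - d%:Z * w.1%:Z - d%:Z * w.2%:Z)%:~R; split=> //.
    by rewrite ler0z; move: leA; clear; lia.
  have -> : (kappa + 1 - d%:Z * w.1%:Z - d%:Z * w.2%:Z)%:~R =
      kappa%:~R + 1 - d%:R * w.1%:R - d%:R * w.2%:R :> R.
    by rewrite 2!rmorphB rmorphD !rmorphM.
  by rewrite natrD; ring.
have sum_le : \sum_c exponent c * (v (toK (f c)))%:~R <=
    d%:R * (\sum_c exponent c * (minwt (supports c) w)%:R) + B.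
  apply: (@le_trans _ _ (\sum_c
    (d%:R * (exponent c * (minwt (supports c) w)%:R) + B * (exponent c * (r c)%:R)))).
    apply: ler_sum => c _.
    have -> : d%:R * (exponent c * (minwt (supports c) w)%:R) + B * (exponent c * (r c)%:R) =
      exponent c * ((minwt (supports c) w)%:R * d%:R + (r c)%:R * B) by ring.
    apply: ler_wpM2l; first exact/ltW/exponent_gt0.
    rewrite Bint; have := vle c; rewrite -(ler_int R) => /le_trans; apply.
    by rewrite rmorphD !rmorphM.
  rewrite big_split /= -!mulr_sumr lerD2l -[X in _ <= X]mulr1.
  exact: ler_wpM2l.
have t0w := Sge0 w wpos.
have tE : d%:R * tdisc exponent supports w <= kappa%:~R - (\sum_c exponent c * (v (toK (f c)))%:~R) + 1.
  rewrite addrAC BE /tdisc; move: sum_le; move: (\sum_c _) (\sum_c _) => p q.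
  by rewrite mulrBr; lra.
apply: le_trans tE; rewrite -[X in X <= _]mul1r; apply: ler_wpM2r => //.
by rewrite ler1n.
Qed.

End LogDiscrepancy.

Lemma meval0_mcoeff (k : comNzRingType) (f : mpoly.mpoly 2 k) :
  mpoly.meval (fun=> 0) f = mpoly.mcoeff (@mpoly.mnm0 2) f.
Proof.
transitivity (@eval2 k k idfun 0 0 f); [|symmetry]; move: f; apply: eval2_unique.
- exact: rmorphD.
- exact: rmorphM.
- exact: mpoly.mevalC.
- exact: mpoly.mevalXU.
- exact: mpoly.mevalXU.
- exact: mpoly.mcoeffD.
- exact: (mpoly.mcoeff0_is_multiplicative _ _).1.
- by move=> z; rewrite mpoly.mcoeffC eqxx mulr1.
- by rewrite mpoly.mcoeffX mpoly.mnm1_eq0.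
- by rewrite mpoly.mcoeffX mpoly.mnm1_eq0.
Qed.

Section ToricCenter.
Variable k : closedFieldType.
Implicit Types (E : prime_divisor k 2) (w : nat * nat).

Lemma toric_divisor_ex w : pos w -> coprime w.1 w.2 -> exists E v, toric_weight E v w.
Proof.
move=> /andP[w1 _] /coprime_det/(_ w1)[a det1].
have [v Ev] := toric_divisor_val k det1.
by exists (toric_divisor k det1), v.
Qed.

Lemma toric_center E v w : toric_weight E v w -> pos w -> center_at_origin E.
Proof.
move=> [Ev tor] /andP[w1 w2]; apply/seteqP; split=> f /=; last first.
  move=> ev0; apply/(center_divisorial Ev).
  have [->|f0] := eqVneq f 0; first by rewrite tofrac0; exact: vge0.
  have tf0 : toK f != 0 by rewrite tofrac_eq0.
  rewrite (vge_neq0 v 1 tf0) tor //.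
  have [u [m fm <-] ->] := minwt_ex w (supp_ex f0).
  have : m != @mpoly.mnm0 2.
    by apply: contraNneq fm => ->; rewrite -meval0_mcoeff ev0.
  rewrite -(inj_eq expo_inj) /expo !mpoly.mnm0E xpair_eqE /wt /=; move: w1 w2.
  by clear; nia.
move=> /(center_divisorial Ev) vf; rewrite meval0_mcoeff; apply/eqP/negPn/negP => fm.
have f0 : f != 0 by apply: contraNneq fm => ->; rewrite mpoly.mcoeff0.
have tf0 : toK f != 0 by rewrite tofrac_eq0.
move: vf; rewrite (vge_neq0 v 1 tf0) tor //.
have le0 : (minwt (supp f) w <= 0)%N.
  apply: leq_trans (@minwt_le _ w (0, 0)%N _) _; last by rewrite /wt !muln0.
  by exists (@mpoly.mnm0 2); rewrite // /expo !mpoly.mnm0E.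
by move: le0; rewrite leqn0 => /eqP ->.
Qed.

Lemma toric_center_pos E v w : toric_weight E v w -> center_at_origin E -> pos w.
Proof.
move=> tw cE; have [vx vy] := toric_weightX tw; have [Ev _] := tw.
have center f : mpoly.meval (fun=> 0) f = 0 -> vge v 1 (toK f).
  by move=> f0; apply/(center_divisorial Ev); rewrite cE.
have x0 : toK (mx0 k) != 0 by rewrite tofrac_eq0 mx0_neq0.
have y0 : toK (mx1 k) != 0 by rewrite tofrac_eq0 mx1_neq0.
have := center (mx0 k) (mpoly.mevalXU _ _); have := center (mx1 k) (mpoly.mevalXU _ _).
by rewrite (vge_neq0 v 1 x0) (vge_neq0 v 1 y0) vx vy /pos => h2 h1; apply/andP; split; [exact: h1|exact: h2].
Qed.

End ToricCenter.

Lemma coprime_noncentered w : coprime w.1 w.2 -> ~~ pos w -> w = (1, 0)%N \/ w = (0, 1)%N.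
Proof.
case: w => w1 w2; rewrite /pos negb_and -!eqn0Ngt /= => cop /orP[]/eqP w0.
  by right; move: cop; rewrite w0 /coprime gcd0n => /eqP ->.
by left; move: cop; rewrite w0 /coprime gcdn0 => /eqP ->.
Qed.

Lemma primitive_weight w : pos w -> exists g w', [/\ (0 < g)%N, pos w', coprime w'.1 w'.2 & w = scalew g w'].
Proof.
case: w => w1 w2 /andP[/= w1_gt0 w2_gt0].
pose g := gcdn w1 w2; have g0 : (0 < g)%N by rewrite gcdn_gt0 w1_gt0.
have d1 : (g * (w1 %/ g) = w1)%N by rewrite mulnC divnK // dvdn_gcdl.
have d2 : (g * (w2 %/ g) = w2)%N by rewrite mulnC divnK // dvdn_gcdr.
exists g, (w1 %/ g, w2 %/ g)%N; split=> //.
- rewrite /pos !lt0n /=; apply/andP; split; apply/eqP => z.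
    by move: w1_gt0; rewrite -d1 z muln0.
  by move: w2_gt0; rewrite -d2 z muln0.
- by rewrite /coprime /= -(eqn_pmul2l g0) muln_gcdr muln1 d1 d2.
- by rewrite /scalew /= d1 d2.
Qed.

(** * Comparison of the mld with toric divisors *)

Section Mld.
Variables (k : closedFieldType) (R : realType) (e : {fset R}) (a : multiideal k 2 e).
Hypothesis he : forall c, c \in e -> 0 < c.
Implicit Types (E : prime_divisor k 2) (w : nat * nat).
Notation T w := (tdisc (@exponent R e) (supports a) w).

Lemma mld_le E : center_at_origin E -> (mld a <= log_discrepancy a E)%E.
Proof. by move=> cE; apply: ereal_inf_lbound; exists E. Qed.

Lemma mld_le_toric w : (forall c, exists u, supports a c u) -> pos w -> coprime w.1 w.2 ->
  (mld a <= (T w)%:E)%E.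
Proof.
move=> S0 wpos cop; have [E [v tw]] := toric_divisor_ex k wpos cop.
rewrite -(log_discrepancy_toric tw cop S0); exact: mld_le (toric_center tw wpos).
Qed.

(** Proper multiples of [w] are not weights of divisors, so a complement [b] is added to keep the
    weights primitive; subadditivity bounds the discrepancy of n w + b by n a(w) + a(b). *)
Lemma mld_neg w : (forall c, exists u, supports a c u) -> pos w -> coprime w.1 w.2 ->
  T w < 0 -> mld a = -oo%E.
Proof.
move=> S0 wpos cop Tneg; have /andP[w1 w2] := wpos.
have [b det1] := coprime_det cop w1.
(* The successor keeps both coordinates positive even if [b] has a zero coordinate. *)
have H n : (mld a <= (n.+1%:R * T w + T b)%:E)%E.
  (* n w + b is primitive because of det1. *)
  pose wn := addw (scalew n.+1 w) b.
  apply: (@le_trans _ _ (T wn)%:E).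
    apply: mld_le_toric => //.
      by move: w1 w2; rewrite /pos /wn /=; clear; case: (w.1) (w.2) => // ? [].
    apply/eqP/eqP; rewrite -dvdn1.
    have E : (w.1 * wn.2 = w.2 * wn.1 + 1)%N by rewrite /wn /=; move: det1; clear; nia.
    by rewrite -(dvdn_addr _ (dvdn_mull w.2 (dvdn_gcdl wn.1 wn.2))) -E dvdn_mull ?dvdn_gcdr.
  rewrite lee_fin -tdisc_scalew //; apply: tdisc_addw_le => //; exact: exponent_gt0.
case mE : (mld a) => [r| |] //.
  have [n nr] := nat_gt_ex ((T b - r) / - T w).
  have := H n; rewrite mE lee_fin leNgt => /negP[].
  move: nr; rewrite ltr_pdivrMr ?oppr_gt0 // -natr1 mulrDl mul1r mulrN.
  by move: Tneg; clear; lra.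
by have := H 0%N; rewrite mE leye_eq.
Qed.

End Mld.

Section ToricApproximation.
Variables (k : closedFieldType) (R : realType) (e : {fset R}) (a : multiideal k 2 e).
Hypothesis he : forall c, c \in e -> 0 < c.
Notation T w := (tdisc (@exponent R e) (supports a) w).

(** If mld < a(w), an approximation within a(w) - mld is a toric divisor with smaller discrepancy
    than every positive weight, hence an axis; the lower bound for arbitrary centered divisors then
    gives a contradiction. *)
Lemma mld_toric_approximation w : (forall c, exists u, supports a c u) ->
  pos w -> coprime w.1 w.2 -> 0 <= T w -> (forall w', pos w' -> T w <= T w') ->
  has_toric_approximation a -> mld a = (T w)%:E.
Proof.
move=> S0 wpos cop Tw0 wmin approx; apply/eqP; rewrite eq_le mld_le_toric //=.
case: approx => [approx|[E [/is_toric_weight[v [w' [tw cop']]] [cE]]]]; last first.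
  rewrite (log_discrepancy_toric tw cop' S0).
  have le : ((T w)%:E <= (T w')%:E)%E.
    by rewrite lee_fin; apply/wmin/(toric_center_pos tw cE).
  case=> [[_ <-]|[_]]; first exact: le.
  by rewrite lte_fin ltNge (le_trans Tw0) // wmin // (toric_center_pos tw cE).
rewrite leNgt; apply/negP => lt.
(* If the mld is -oo, its distance to a finite log discrepancy is +oo, so no approximation
   exists. *)
case mE : (mld a) lt => [r| |] // lt; last first.
  have [E [/is_toric_weight[v [w' [tw cop']]]]] := approx 1 ltr01.
  by rewrite (log_discrepancy_toric tw cop' S0) mE.
rewrite lte_fin -subr_gt0 in lt.
have [E [/is_toric_weight[v [w' [tw cop']]]]] := approx _ lt.
rewrite (log_discrepancy_toric tw cop' S0) mE -EFinB abse_EFin lte_fin.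
move=> /(le_lt_trans (ler_norm _)); rewrite ltrD2r => Tlt.
have w'neg : ~~ pos w' by apply/negP => /wmin; rewrite leNgt Tlt.
have mult : T (1, 0)%N < T (1, 1)%N \/ T (0, 1)%N < T (1, 1)%N.
  have lt11 : T w' < T (1, 1)%N by apply: lt_le_trans Tlt (wmin _ _).
  by case: (coprime_noncentered cop' w'neg) lt11 => ->; [left|right].
have Tge0 w1 : pos w1 -> 0 <= T w1 by move=> /wmin; apply: le_trans.
suff : ((T w)%:E <= mld a)%E by rewrite mE lee_fin leNgt -subr_gt0 lt.
apply: le_ereal_inf_tmp => _ [E' cE' <-].
have [w1 w1pos] := log_discrepancy_ge_toric he S0 Tge0 mult cE'.
by apply: le_trans; rewrite lee_fin wmin.
Qed.

End ToricApproximation.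

Unset Implicit Arguments.
Set Strict Implicit.

Theorem corollary1p9 (R : realType) (k : closedFieldType) (p : nat)
    (hp : p \in [pchar k]) (e : {fset R})
    (he : forall c : R, c \in e -> 0 < c) :
  exists l : nat, (0 < l)%N /\
    forall a : multiideal k 2 e, in_Mk a ->
      exists E : prime_divisor k 2,
        computes_mld a E /\ (kE E R <= (l%:R)%:E)%E.
Proof.
have [l0 l0P] := @tdisc_bounded_min R e (@exponent R e) (exponent_gt0 he).
(* A positive primitive weight of sum at most [l0] has k_E < l0; the successor also covers the
   blow-up of the origin, with k_E = 1, which is used when some ideal is zero. *)
exists l0.+1; split=> // a [_ _ approx].
have kE_le E v (w : nat * nat) l : toric_weight E v w -> coprime w.1 w.2 ->
    (w.1 + w.2 <= l.+1)%N -> (kE E R <= (l%:R)%:E)%E.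
  move=> tw cop wl; rewrite (toric_weight_kE R tw cop) lee_fin lerBlDr natr1.
  by rewrite ler_nat.
have [S0|/existsNP[c nS]] := pselect (forall c, exists u, supports a c u); last first.
  have [E [v tw]] := @toric_divisor_ex k (1, 1)%N isT isT.
  have cE := toric_center tw isT.
  have dE := log_discrepancy_zero he tw isT nS.
  exists E; split; last exact: kE_le tw _ _.
  split=> //; right; split; last by rewrite dE ltNy0.
  by apply/eqP; rewrite -leeNy_eq -dE; exact: mld_le.
have [w0 [w0pos w0l w0min]] := l0P (supports a) S0.
(* The bounded weight need not be primitive; homogeneity passes its sign or minimality on to its
   primitive part. *)
have [g [w [g0 wpos cop w0E]]] := primitive_weight w0pos.
have Tw0 : tdisc (@exponent R e) (supports a) w0 = g%:R * tdisc (@exponent R e) (supports a) w.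
  by rewrite w0E tdisc_scalew.
have wl : (w.1 + w.2 <= l0)%N.
  by apply: leq_trans w0l; rewrite w0E /= -mulnDr leq_pmull.
have [E [v tw]] := toric_divisor_ex k wpos cop.
have cE := toric_center tw wpos.
have dE := log_discrepancy_toric tw cop S0.
exists E; split; last by apply: kE_le tw cop _; lia.
split=> //; have [Tneg|Tge0] := ltP (tdisc (@exponent R e) (supports a) w) 0.
  by right; rewrite (mld_neg he S0 wpos cop Tneg) dE lte_fin.
left; rewrite dE.
have g1 : 1 <= g%:R :> R by rewrite ler1n.
have wmin w' : pos w' -> tdisc (@exponent R e) (supports a) w <= tdisc (@exponent R e) (supports a) w'.
  case: w0min => [|H w'pos]; first by rewrite Tw0 ltNge mulr_ge0 // ler0n.
  apply: le_trans (H w' w'pos); rewrite Tw0 -[X in X <= _]mul1r.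
  exact: ler_wpM2r.
by rewrite (mld_toric_approximation he S0 wpos cop Tge0 wmin approx) lee_fin.
Qed.
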